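(* Let $\alpha\ge 0$ and let $\varphi$ be analytic with positive real part in $\mathbb{D}$, with $\varphi(0)=1$, $\varphi'(0)>0$, $\varphi(\mathbb{D})$ symmetric with respect to the real axis, and Taylor expansion $\varphi(z)=1+B_1z+B_2z^2+B_3z^3+\cdots$ (so $B_1>0$). If $f(z)=z+\sum_{n=2}^{\infty}a_nz^n$ belongs to the class $\mathcal{ST}_{\sigma}(\alpha,\varphi)$, then $$|a_2|\le\frac{B_1\sqrt{B_1}}{\sqrt{|B_1^2(1+4\alpha)+(B_1-B_2)(1+2\alpha)^2|}}\qquad\text{and}\qquad |a_3|\le\frac{B_1+|B_2-B_1|}{1+4\alpha}.$$
   Context: $\mathbb{D}=\{z\in\mathbb{C}:|z|<1\}$. $\mathcal{A}$ is the class of analytic functions $f$ on $\mathbb{D}$ with $f(0)=0$ and $f'(0)=1$. A function is univalent if it is analytic and injective. A function $f\in\mathcal{A}$ is bi-univalent if both $f$ and its inverse $f^{-1}$ are univalent in $\mathbb{D}$; that is, $f$ is univalent in $\mathbb{D}$ and the inverse of $f$, defined near $0$, extends to a univalent function on $\mathbb{D}$, still denoted $g=f^{-1}$. The class of bi-univalent functions is $\sigma$. An analytic function $F$ on $\mathbb{D}$ is subordinate to an analytic function $G$ on $\mathbb{D}$, written $F\prec G$, if there is an analytic $w:\mathbb{D}\to\mathbb{D}$ with $w(0)=0$ and $F(z)=G(w(z))$ for all $z\in\mathbb{D}$. A function $f\in\sigma$ is in $\mathcal{ST}_{\sigma}(\alpha,\varphi)$ if $$\frac{zf'(z)}{f(z)}+\frac{\alpha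 z^2f''(z)}{f(z)}\prec\varphi(z)\quad\text{and}\quad \frac{wg'(w)}{g(w)}+\frac{\alpha w^2g''(w)}{g(w)}\prec\varphi(w),\qquad g=f^{-1}$$ (the quotients are taken with their removable singularity at $0$ filled in). Convention: a bound whose denominator vanishes is regarded as $+\infty$ (no assertion). *)

(* Defs.v *)
From Stdlib Require Import Reals.
From Coquelicot Require Import Coquelicot.
Open Scope R_scope.

(* Functions on the disk are total functions [C -> C] whose values outside
   the disk are irrelevant. *)
Definition disk (z : C) : Prop := Cmod z < 1.

(* [ex_derive] is taken over the field [C], hence complex differentiability. *)
Definition analytic (f : C -> C) : Prop :=
  forall z : C, disk z -> ex_derive (K := C_AbsRing) (V := C_NormedModule) f z.

Definition univalent (f : C -> C) : Prop :=
  analytic f /\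
  forall z1 z2 : C, disk z1 -> disk z2 -> f z1 = f z2 -> z1 = z2.

Definition class_A (f : C -> C) : Prop :=
  analytic f /\ f 0%C = 0%C /\ C_derive f 0%C = 1%C.

(* Since [f 0 = 0] and [f] is open, the condition near [0] says that [g]
   agrees with the local inverse of [f] on a neighbourhood of [0]; [g] is then
   unique on the disk. *)
Definition univalent_inverse (f g : C -> C) : Prop :=
  univalent g /\ locally (0%C : C) (fun z : C => g (f z) = z).

Definition bi_univalent (f : C -> C) : Prop :=
  class_A f /\ univalent f /\ exists g : C -> C, univalent_inverse f g.

Definition subordinate (F G : C -> C) : Prop :=
  analytic F /\ analytic G /\
  exists w : C -> C,
    analytic w /\ (forall z : C, disk z -> disk (w z)) /\ w 0%C = 0%C /\
    forall z : C, disk z -> F z = G (w z).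

(* [F] is [h] with its removable singularity at [0] filled in. *)
Definition removable_ext (h F : C -> C) : Prop :=
  analytic F /\ forall z : C, disk z -> z <> 0%C -> F z = h z.

Definition st_expr (alpha : R) (f : C -> C) (z : C) : C :=
  (z * C_derive f z / f z
   + alpha * z ^ 2 * C_derive (C_derive f) z / f z)%C.

Definition st_subordinate (alpha : R) (f phi : C -> C) : Prop :=
  exists F : C -> C, removable_ext (st_expr alpha f) F /\ subordinate F phi.

Definition class_ST (alpha : R) (phi f : C -> C) : Prop :=
  bi_univalent f /\
  exists g : C -> C,
    univalent_inverse f g /\
    st_subordinate alpha f phi /\ st_subordinate alpha g phi.

Definition positive_real (c : C) : Prop := 0 < Re c /\ Im c = 0.

Definition admissible_phi (phi : C -> C) : Prop :=
  analytic phi /\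
  (forall z : C, disk z -> 0 < Re (phi z)) /\
  phi 0%C = 1%C /\
  positive_real (C_derive phi 0%C) /\
  (forall z : C, disk z -> exists z' : C, disk z' /\ phi z' = Cconj (phi z)).

Definition taylor_expansion (f : C -> C) (a : nat -> C) : Prop :=
  forall z : C, disk z ->
    is_pseries (K := C_AbsRing) (V := C_NormedModule) a z (f z).

(* Main.v *)
Require Import Defs.
From Stdlib Require Import Reals Lra Lia Psatz IndefiniteDescription.
From Coquelicot Require Import Coquelicot.
Open Scope R_scope.

(** The subordinations say that the starlike expressions of [f] and of [g = f^-1]
    are [phi o u] and [phi o v] for Schwarz functions [u] and [v]. Expanding both
    sides to second order at the origin gives, with [A = alpha] and [Bk] the
    coefficients of [phi],
    - [(1 + 2 A) a2 = B1 u1] and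
      [(2 + 6 A) a3 - (1 + 2 A) a2^2 = B1 u2 + B2 u1^2];
    - [- (1 + 2 A) a2 = B1 v1] and
      [(3 + 10 A) a2^2 - (2 + 6 A) a3 = B1 v2 + B2 v1^2].

    Hence [v1 = - u1]. With [U = u2 + u1^2] and [V = v2 + v1^2], the sum of the
    second-order relations is
    [(2 + 8 A) a2^2 = B1 (U + V) + 2 (B2 - B1) u1^2] and their difference
    expresses [a3 - a2^2] by [U - V]. Both bounds then follow from
    [|u1| <= 1], [|U| <= 1] and [|V| <= 1] ([a2_bound], [a3_bound]).

    These three inequalities are Caratheodory's bound [|p_k| <= 2] for
    [p = (1 + u) / (1 - u) = 1 + 2 u1 z + 2 U z^2 + ...], which has positive real
    part ([schwarz_jet2]). Caratheodory's bound comes from integrating [p] over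
    circles against a nonnegative trigonometric kernel, and only requires that
    circle means of functions holomorphic in the punctured disk do not depend on
    the radius ([circle_int_indep]). That is Goursat's theorem for rectangles
    ([goursat_rectangle]) in the coordinate [log z]; Goursat's form is the one
    needed, because [u] and [v] are merely complex differentiable.

    The expansions are handled by a calculus of second-order expansions with
    continuous remainder factor ([jet2]). Those of [phi] and [f] come from termwise
    differentiation of power series ([taylor_is_Cderive]); those of [u], [v] and
    [g] are deduced from the functional equations [phi o u = F], [phi o v = G]
    and [f o g = id] ([jet2_of_comp]). *)

(** * Continuity and differentiation of functions of a complex variable *)

(** The uniform structure of [C] is the product one, whose balls are squares;
    this restates neighbourhoods with the modulus. *)
Lemma locally_Cmod (z : C) (P : C -> Prop) :
  locally z P <-> exists d : posreal, forall y, Cmod (y - z) < d -> P y.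
Proof.
  split.
  - intros [d Hd]; exists d; intros y Hy. apply Hd.
    apply C_NormedModule_mixin_compat1, Hy.
  - intros [d Hd].
    assert (Hs : 0 < sqrt 2) by (apply sqrt_lt_R0; lra).
    assert (He : 0 < d / sqrt 2) by (apply Rdiv_lt_0_compat; [apply d | lra]).
    exists (mkposreal _ He); intros y Hy. apply Hd.
    replace (pos d) with (sqrt 2 * (d / sqrt 2)) by (field; lra).
    exact (C_NormedModule_mixin_compat2 z y (mkposreal _ He) Hy).
Qed.

Lemma continuous_Cmod (f : C -> C) (z : C) :
  continuous f z <->
  forall eps : posreal, exists d : posreal,
    forall y, Cmod (y - z) < d -> Cmod (f y - f z) < eps.
Proof.
  split.
  - intros Hf eps.
    apply (locally_Cmod z (fun y => Cmod (f y - f z) < eps)).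
    apply (Hf (fun w => Cmod (w - f z) < eps)).
    apply locally_Cmod. exists eps; auto.
  - intros H P HP. apply locally_Cmod in HP. destruct HP as [e He].
    apply locally_Cmod. destruct (H e) as [d Hd]. exists d; auto.
Qed.

Lemma continuous_Cplus (f g : C -> C) (z : C) :
  continuous f z -> continuous g z -> continuous (fun y => (f y + g y)%C) z.
Proof. exact (continuous_plus (V := C_NormedModule) f g z). Qed.

Lemma continuous_Copp (f : C -> C) (z : C) :
  continuous f z -> continuous (fun y => (- f y)%C) z.
Proof. exact (continuous_opp (V := C_NormedModule) f z). Qed.

Lemma continuous_Cminus (f g : C -> C) (z : C) :
  continuous f z -> continuous g z -> continuous (fun y => (f y - g y)%C) z.
Proof. exact (continuous_minus (V := C_NormedModule) f g z). Qed.

Lemma continuous_Cmult (f g : C -> C) (z : C) :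
  continuous f z -> continuous g z -> continuous (fun y => (f y * g y)%C) z.
Proof.
  intros Hf Hg.
  assert (tr : forall h : C -> C,
    continuous (T := C_UniformSpace) (U := C_UniformSpace) h z <->
    continuous (T := C_UniformSpace) (U := AbsRing_UniformSpace C_AbsRing) h z).
  { intros h; split; intros H P HP; apply H, locally_C, HP. }
  apply (tr (fun y => (f y * g y)%C)).
  apply (continuous_mult (K := C_AbsRing) f g z); apply tr; assumption.
Qed.

Lemma continuous_Cinv (f : C -> C) (z : C) :
  continuous f z -> f z <> (RtoC 0) -> continuous (fun y => (/ f y)%C) z.
Proof.
  intros Hf H0. apply continuous_Cmod. intros eps.
  assert (Hm := proj1 (Cmod_gt_0 _) H0). set (m := Cmod (f z)) in *.
  assert (He : 0 < Rmin (m / 2) (eps * m * m / 2)).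
  { destruct eps as [e He]; simpl. apply Rmin_glb_lt; try lra.
    assert (0 < e * m * m) by (repeat apply Rmult_lt_0_compat; auto). lra. }
  destruct (proj1 (continuous_Cmod f z) Hf (mkposreal _ He)) as [d Hd].
  exists d. intros y Hy. specialize (Hd y Hy). simpl in Hd.
  assert (H1 := Rlt_le_trans _ _ _ Hd (Rmin_l _ _)).
  assert (H2 := Rlt_le_trans _ _ _ Hd (Rmin_r _ _)).
  assert (H3 : m / 2 < Cmod (f y)).
  { assert (T := Cmod_triangle (f y) (-(f y - f z))). rewrite Cmod_opp in T.
    replace (f y + - (f y - f z))%C with (f z) in T by ring. fold m in T. lra. }
  assert (H4 : f y <> (RtoC 0)) by (apply Cmod_gt_0; lra).
  replace (/ f y - / f z)%C with (- (f y - f z) / (f y * f z))%C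
    by (field; auto).
  rewrite Cmod_div, Cmod_opp, Cmod_mult by (apply Cmult_neq_0; auto). fold m.
  apply Rlt_div_l; [ apply Rmult_lt_0_compat; lra | ].
  apply Rlt_le_trans with (1 := H2).
  replace (eps * m * m / 2) with (eps * (m / 2 * m)) by field.
  apply Rmult_le_compat_l; [ apply Rlt_le, eps | ].
  apply Rmult_le_compat_r; lra.
Qed.

Lemma continuous_Cneq_0 (f : C -> C) (z : C) :
  continuous f z -> f z <> (RtoC 0) -> locally z (fun y => f y <> (RtoC 0)).
Proof.
  intros Hf H0. apply (Hf (fun w : C => w <> (RtoC 0))). apply locally_Cmod.
  assert (Hm := proj1 (Cmod_gt_0 _) H0). exists (mkposreal _ Hm); simpl.
  intros w Hw E. rewrite E in Hw.
  replace (0 - f z)%C with (- f z)%C in Hw by ring.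
  rewrite Cmod_opp in Hw. lra.
Qed.

Lemma continuous_Cpow (f : C -> C) (n : nat) (z : C) :
  continuous f z -> continuous (fun y => (f y ^ n)%C) z.
Proof.
  intros Hf; induction n as [|n IH]; simpl.
  - apply continuous_const.
  - apply continuous_Cmult; assumption.
Qed.

(** The function is matched syntactically before a closure lemma is applied:
    plain [apply] would read a constant function as a sum and loop. *)
Ltac cont :=
  lazymatch goal with
  | |- continuous (fun _ => ?c) _ => apply continuous_const
  | |- continuous (fun x => x) _ => apply continuous_id
  | |- continuous (fun x => Cplus (@?f x) (@?g x)) _ =>
      apply (continuous_Cplus f g); cont
  | |- continuous (fun x => Cminus (@?f x) (@?g x)) _ =>
      apply (continuous_Cminus f g); cont
  | |- continuous (fun x => Copp (@?f x)) _ => apply (continuous_Copp f); cont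
  | |- continuous (fun x => Cmult (@?f x) (@?g x)) _ =>
      apply (continuous_Cmult f g); cont
  | |- continuous (fun x => Cpow (@?f x) ?n) _ => apply (continuous_Cpow f n); cont
  | |- _ => try assumption
  end.

Notation is_Cderive := (is_derive (K := C_AbsRing) (V := C_NormedModule)).

Lemma is_Cderive_eps (f : C -> C) (z l : C) :
  is_Cderive f z l <->
  forall eps : posreal, exists d : posreal, forall y, Cmod (y - z) < d ->
    Cmod (f y - f z - (y - z) * l) <= eps * Cmod (y - z).
Proof.
  split.
  - intros [_ H] eps.
    specialize (H z (fun P HP => HP) eps).
    apply locally_C, locally_Cmod in H. destruct H as [d Hd]. exists d.
    intros y Hy. exact (Hd y Hy).
  - intros H. split; [ apply is_linear_scal_l | ].
    intros x Hx eps. 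
    assert (E : z = x) by (apply (is_filter_lim_locally_unique (V := AbsRing_NormedModule C_AbsRing) z x), Hx).
    subst x. destruct (H eps) as [d Hd].
    apply locally_C, locally_Cmod. exists d. exact Hd.
Qed.

(** Caratheodory's form of differentiability: the difference quotient extends
    continuously. The product, quotient and chain rules, and later the removal
    of singularities at the origin, become statements about continuity. *)
Lemma is_Cderive_slope (f : C -> C) (z l : C) :
  is_Cderive f z l <->
  exists q : C -> C, continuous q z /\ q z = l /\
    locally z (fun y => f y = (f z + (y - z) * q y)%C).
Proof.
  rewrite is_Cderive_eps. split.
  - intros H.
    exists (fun y => if Ceq_dec y z then l else ((f y - f z) / (y - z))%C).
    split; [ | split ].
    + apply continuous_Cmod. intros eps.
      destruct (H (pos_div_2 eps)) as [d Hd]. exists d. intros y Hy.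
      destruct (Ceq_dec z z) as [_|]; [ | congruence ].
      destruct (Ceq_dec y z) as [->|Hyz].
      * replace (l - l)%C with (RtoC 0) by ring. rewrite Cmod_0. apply eps.
      * assert (Hn : (y - z)%C <> (RtoC 0)) by (apply Cminus_eq_contra; auto).
        assert (Hp := proj1 (Cmod_gt_0 _) Hn).
        specialize (Hd y Hy).
        replace ((f y - f z) / (y - z) - l)%C
          with ((f y - f z - (y - z) * l) / (y - z))%C by (field; auto).
        rewrite Cmod_div by auto.
        apply Rlt_div_l; auto.
        apply Rle_lt_trans with (1 := Hd). apply Rmult_lt_compat_r; auto.
        simpl. assert (h := cond_pos eps). lra.
    + destruct (Ceq_dec z z); congruence.
    + apply filter_forall. intros y. destruct (Ceq_dec y z) as [->|Hyz].
      * ring.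
      * field. apply Cminus_eq_contra; auto.
  - intros (q & Hq & Hl & He) eps.
    apply locally_Cmod in He. destruct He as [d1 H1].
    destruct (proj1 (continuous_Cmod q z) Hq eps) as [d2 H2].
    assert (Hd : 0 < Rmin d1 d2) by (apply Rmin_glb_lt; apply cond_pos).
    exists (mkposreal _ Hd). simpl. intros y Hy.
    rewrite H1 by (apply Rlt_le_trans with (1 := Hy), Rmin_l).
    subst l.
    replace (f z + (y - z) * q y - f z - (y - z) * q z)%C
      with ((q y - q z) * (y - z))%C by ring.
    rewrite Cmod_mult. apply Rmult_le_compat_r; [ apply Cmod_ge_0 | ].
    apply Rlt_le, H2. apply Rlt_le_trans with (1 := Hy), Rmin_r.
Qed.

Lemma is_Cderive_continuous (f : C -> C) (z l : C) :
  is_Cderive f z l -> continuous f z.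
Proof.
  intros H. apply is_Cderive_slope in H. destruct H as (q & Hq & _ & He).
  apply continuous_ext_loc with (g := fun y => (f z + (y - z) * q y)%C).
  - revert He. apply filter_imp. intros y Hy; symmetry; exact Hy.
  - apply continuous_Cplus; [ apply continuous_const | ].
    apply continuous_Cmult; [ | exact Hq ].
    apply continuous_Cminus; [ apply continuous_id | apply continuous_const ].
Qed.

Lemma is_Cderive_mult (f g : C -> C) (z df dg : C) :
  is_Cderive f z df -> is_Cderive g z dg ->
  is_Cderive (fun y => (f y * g y)%C) z (df * g z + f z * dg)%C.
Proof.
  intros Hf Hg.
  assert (Cg := is_Cderive_continuous _ _ _ Hg).
  apply is_Cderive_slope in Hf. destruct Hf as (q & Hq & <- & He).
  apply is_Cderive_slope in Hg. destruct Hg as (r & Hr & <- & Ge).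
  apply is_Cderive_slope.
  exists (fun y => (q y * g y + f z * r y)%C).
  split; [ | split ]; [ | reflexivity | ].
  - apply continuous_Cplus; apply continuous_Cmult; auto. apply continuous_const.
  - generalize (filter_and _ _ He Ge). apply filter_imp.
    intros y [-> ->]. ring.
Qed.

Lemma is_Cderive_inv (f : C -> C) (z df : C) :
  is_Cderive f z df -> f z <> (RtoC 0) ->
  is_Cderive (fun y => (/ f y)%C) z (- df / (f z * f z))%C.
Proof.
  intros Hf H0.
  assert (Cf := is_Cderive_continuous _ _ _ Hf).
  apply is_Cderive_slope in Hf. destruct Hf as (q & Hq & <- & He).
  apply is_Cderive_slope.
  exists (fun y => (- q y * / (f y * f z))%C).
  split; [ | split ]; [ | reflexivity | ].
  - apply continuous_Cmult; [ apply continuous_Copp; exact Hq | ].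
    apply continuous_Cinv; [ | apply Cmult_neq_0; auto ].
    apply continuous_Cmult; [ exact Cf | apply continuous_const ].
  - assert (Hn := continuous_Cneq_0 f z Cf H0).
    generalize (filter_and _ _ He Hn). apply filter_imp.
    intros y [Hy Hy0]. rewrite Hy in Hy0 |- *. field. auto.
Qed.

Lemma is_Cderive_comp (f g : C -> C) (z df dg : C) :
  is_Cderive f (g z) df -> is_Cderive g z dg ->
  is_Cderive (fun y => f (g y)) z (dg * df)%C.
Proof.
  intros Hf Hg.
  assert (Cg := is_Cderive_continuous _ _ _ Hg).
  apply is_Cderive_slope in Hf. destruct Hf as (q & Hq & <- & He).
  apply is_Cderive_slope in Hg. destruct Hg as (r & Hr & <- & Ge).
  apply is_Cderive_slope.
  exists (fun y => (r y * q (g y))%C).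
  split; [ | split ]; [ | reflexivity | ].
  - apply continuous_Cmult; auto. apply continuous_comp; auto.
  - assert (Hl : locally z (fun y => f (g y) = (f (g z) + (g y - g z) * q (g y))%C))
      by exact (Cg _ He).
    generalize (filter_and _ _ Hl Ge). apply filter_imp.
    intros y [-> Hy]. replace (g y - g z)%C with ((y - z) * r y)%C; [ ring | ].
    rewrite Hy. ring.
Qed.

Lemma is_Cderive_ext_loc (f g : C -> C) (z l : C) :
  locally z (fun y : C => f y = g y) -> is_Cderive f z l -> is_Cderive g z l.
Proof.
  intros E. apply (is_derive_ext_loc (V := C_NormedModule)). apply locally_C, E.
Qed.

Lemma is_Cderive_plus (f g : C -> C) (z df dg : C) :
  is_Cderive f z df -> is_Cderive g z dg ->
  is_Cderive (fun y => (f y + g y)%C) z (df + dg)%C.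
Proof. exact (is_derive_plus (V := C_NormedModule) f g z df dg). Qed.

Lemma is_Cderive_minus (f g : C -> C) (z df dg : C) :
  is_Cderive f z df -> is_Cderive g z dg ->
  is_Cderive (fun y => (f y - g y)%C) z (df - dg)%C.
Proof. exact (is_derive_minus (V := C_NormedModule) f g z df dg). Qed.

Lemma is_Cderive_const (c z : C) : is_Cderive (fun _ => c) z (RtoC 0).
Proof. exact (is_derive_const (V := C_NormedModule) c z). Qed.

Lemma is_Cderive_id (z : C) : is_Cderive (fun y => y) z (RtoC 1).
Proof.
  apply is_Cderive_slope. exists (fun _ => 1%C).
  split; [ apply continuous_const | split; [ reflexivity | ] ].
  assert (E : forall y : C, y = (z + (y - z) * 1)%C) by (intros y; ring).
  apply filter_forall. exact E.
Qed.

(** * Second-order expansions at the origin *)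

(** [f z = c0 + c1 z + c2 z^2 + o(z^2)], with the error term kept as a factor
    of [z^2] that is continuous at the origin, so that expansions can be added,
    multiplied, inverted and composed by algebra. *)
Definition jet2 (f : C -> C) (c0 c1 c2 : C) : Prop :=
  exists h : C -> C, continuous h (RtoC 0) /\ h (RtoC 0) = c2 /\
    locally (RtoC 0) (fun z : C => f z = (c0 + c1 * z + z ^ 2 * h z)%C).

Lemma jet2_0 f c0 c1 c2 : jet2 f c0 c1 c2 -> f (RtoC 0) = c0.
Proof.
  intros (h & _ & _ & H). apply locally_singleton in H. rewrite H. ring.
Qed.

Lemma jet2_ext_loc f g c0 c1 c2 :
  locally (RtoC 0) (fun z : C => f z = g z) -> jet2 f c0 c1 c2 -> jet2 g c0 c1 c2.
Proof.
  intros E (h & Ch & H2 & H). exists h. split; [ exact Ch | split; [ exact H2 | ] ].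
  generalize (filter_and _ _ E H). apply filter_imp. intros z [<- ->]. reflexivity.
Qed.

Lemma jet2_continuous f c0 c1 c2 : jet2 f c0 c1 c2 -> continuous f (RtoC 0).
Proof.
  intros (h & Ch & _ & H).
  apply continuous_ext_loc with (g := fun z => (c0 + c1 * z + z ^ 2 * h z)%C).
  - revert H. apply filter_imp. intros z ->; reflexivity.
  - apply continuous_Cplus.
    + apply continuous_Cplus; [ apply continuous_const | ].
      apply continuous_Cmult; [ apply continuous_const | apply continuous_id ].
    + apply continuous_Cmult; auto. apply continuous_Cpow, continuous_id.
Qed.

Lemma jet2_const c : jet2 (fun _ => c) c 0 0.
Proof.
  exists (fun _ => RtoC 0). split; [ apply continuous_const | split; [ reflexivity | ] ].
  apply filter_forall. intros z. ring.
Qed.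

Lemma jet2_id : jet2 (fun z => z) 0 1 0.
Proof.
  exists (fun _ => RtoC 0). split; [ apply continuous_const | split; [ reflexivity | ] ].
  assert (E : forall z : C, z = (0 + 1 * z + z ^ 2 * 0)%C) by (intros z; ring).
  apply filter_forall. exact E.
Qed.

Lemma jet2_plus f g a0 a1 a2 b0 b1 b2 :
  jet2 f a0 a1 a2 -> jet2 g b0 b1 b2 ->
  jet2 (fun z => f z + g z)%C (a0 + b0) (a1 + b1) (a2 + b2).
Proof.
  intros (h & Ch & <- & H) (k & Ck & <- & K).
  exists (fun z => h z + k z)%C.
  split; [ apply continuous_Cplus; auto | split; [ reflexivity | ] ].
  generalize (filter_and _ _ H K). apply filter_imp. intros z [-> ->]. ring.
Qed.

Lemma jet2_mult f g a0 a1 a2 b0 b1 b2 :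
  jet2 f a0 a1 a2 -> jet2 g b0 b1 b2 ->
  jet2 (fun z => f z * g z)%C (a0 * b0) (a0 * b1 + a1 * b0)
    (a0 * b2 + a1 * b1 + a2 * b0).
Proof.
  intros (h & Ch & <- & H) (k & Ck & <- & K).
  exists (fun z => a0 * k z + a1 * b1 + h z * b0
                   + z * (a1 * k z + b1 * h z + z * h z * k z))%C.
  split; [ cont | split; [ ring | ] ].
  generalize (filter_and _ _ H K). apply filter_imp. intros z [-> ->]. ring.
Qed.

Lemma jet2_inv f a0 a1 a2 :
  a0 <> (RtoC 0) -> jet2 f a0 a1 a2 ->
  jet2 (fun z => / f z)%C (/ a0) (- a1 / (a0 * a0))
    (a1 * a1 / (a0 * a0 * a0) - a2 / (a0 * a0)).
Proof.
  intros H0 Hf. assert (Cf := jet2_continuous _ _ _ _ Hf).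
  assert (E0 := jet2_0 _ _ _ _ Hf).
  destruct Hf as (h & Ch & <- & H).
  exists (fun z => (a1 * a1 * (/ a0 * / a0) - h z * / a0 + h z * a1 * z * (/ a0 * / a0)) * / f z)%C.
  split; [ | split ].
  - cont. apply continuous_Cinv; [ exact Cf | congruence ].
  - rewrite E0. field; auto.
  - assert (Hn : locally (RtoC 0) (fun y => f y <> (RtoC 0)))
      by (apply continuous_Cneq_0; [ exact Cf | rewrite E0; exact H0 ]).
    generalize (filter_and _ _ H Hn). apply filter_imp. intros z [E Hz].
    rewrite E in Hz |- *. field; auto.
Qed.

Lemma jet2_comp f u a0 a1 a2 b1 b2 :
  jet2 f a0 a1 a2 -> jet2 u 0 b1 b2 ->
  jet2 (fun z => f (u z)) a0 (a1 * b1) (a1 * b2 + a2 * (b1 * b1)).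
Proof.
  intros (h & Ch & <- & H) Hu.
  assert (Cu := jet2_continuous _ _ _ _ Hu).
  assert (E0 := jet2_0 _ _ _ _ Hu).
  destruct Hu as (k & Ck & <- & K).
  exists (fun z => a1 * k z + (b1 + z * k z) ^ 2 * h (u z))%C.
  split; [ | split ].
  - cont. apply continuous_comp; [ exact Cu | ]. rewrite E0. exact Ch.
  - rewrite E0. ring.
  - assert (Hl : locally (RtoC 0) (fun z : C => f (u z) = (a0 + a1 * u z + u z ^ 2 * h (u z))%C)).
    { apply (Cu (fun w : C => f w = (a0 + a1 * w + w ^ 2 * h w)%C)). rewrite E0. exact H. }
    generalize (filter_and _ _ Hl K). apply filter_imp. intros z [-> E].
    rewrite E at 1 2. ring.
Qed.

Lemma Cmult_cancel_l (c x y : C) : c <> 0%C -> (c * x = c * y)%C -> x = y.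
Proof.
  intros Hc E. replace x with (/ c * (c * x))%C by (field; auto).
  rewrite E. field; auto.
Qed.

Lemma Cplus_cancel_l (c x y : C) : (c + x = c + y)%C -> x = y.
Proof.
  intros E. replace x with ((c + x) - c)%C by ring. rewrite E. ring.
Qed.

Lemma continuous_eq_punctured (h k : C -> C) :
  continuous h (RtoC 0) -> continuous k (RtoC 0) ->
  locally (RtoC 0) (fun z : C => z <> (RtoC 0) -> h z = k z) -> h (RtoC 0) = k (RtoC 0).
Proof.
  intros Ch Ck H.
  assert (Cd : continuous (fun z => h z - k z)%C (RtoC 0)) by (apply continuous_Cminus; auto).
  destruct (Ceq_dec (h (RtoC 0) - k (RtoC 0))%C (RtoC 0)) as [E|E].
  - replace (h (RtoC 0)) with ((h (RtoC 0) - k (RtoC 0)) + k (RtoC 0))%C by ring. rewrite E. ring.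
  - exfalso. generalize (filter_and _ _ H (continuous_Cneq_0 _ _ Cd E)).
    intros L. apply locally_Cmod in L. destruct L as [d Hd].
    assert (Hp := cond_pos d).
    assert (Hz : Cmod (RtoC (d / 2) - 0)%C < d).
    { replace (RtoC (d / 2) - 0)%C with (RtoC (d / 2)) by ring.
      rewrite Cmod_R, Rabs_pos_eq; lra. }
    destruct (Hd _ Hz) as [H1 H2]. apply H2. rewrite H1; [ ring | ].
    intros E0. apply RtoC_inj in E0. lra.
Qed.

Lemma jet2_unique f a0 a1 a2 b0 b1 b2 :
  jet2 f a0 a1 a2 -> jet2 f b0 b1 b2 -> a0 = b0 /\ a1 = b1 /\ a2 = b2.
Proof.
  intros Ha Hb.
  assert (E0 : a0 = b0) by (rewrite <- (jet2_0 _ _ _ _ Ha); apply (jet2_0 _ _ _ _ Hb)).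
  destruct Ha as (h & Ch & <- & H). destruct Hb as (k & Ck & <- & K). subst b0.
  assert (L := filter_and _ _ H K).
  assert (E1 : a1 = b1).
  { assert (E := continuous_eq_punctured (fun z => a1 + z * h z)%C (fun z => b1 + z * k z)%C).
    simpl in E. replace a1 with (a1 + 0 * h 0)%C by ring.
    rewrite E; [ ring | cont | cont | ].
    revert L. apply filter_imp. intros z [E1 E2] Hz.
    apply (Cmult_cancel_l z); [ exact Hz | ].
    apply (Cplus_cancel_l a0).
    transitivity (f z); [ rewrite E1 | rewrite E2 ]; ring. }
  subst b1. split; [ reflexivity | split; [ reflexivity | ] ].
  apply continuous_eq_punctured; auto.
  revert L. apply filter_imp. intros z [E1 E2] Hz.
  apply (Cmult_cancel_l (z ^ 2)%C).
  - apply Cpow_nz. exact Hz.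
  - apply (Cplus_cancel_l (a0 + a1 * z)%C). congruence.
Qed.

(** A local inverse function argument at the level of expansions: if [f] has
    nonzero linear coefficient then the expansion of [f o u] determines that of
    [u]. Writing [u z = z q z], the equation
    [a1 u = b1 z + z^2 (k - q^2 (h o u))] is already an expansion of [u]. It is
    used for a Schwarz function [u] with [f = phi], and for [u = f^-1]. *)
Lemma jet2_of_comp f u a0 a1 a2 b0 b1 b2 :
  a1 <> (RtoC 0) -> jet2 f a0 a1 a2 ->
  u (RtoC 0) = (RtoC 0) -> ex_derive (K := C_AbsRing) (V := C_NormedModule) u (RtoC 0) ->
  jet2 (fun z => f (u z)) b0 b1 b2 ->
  exists u1 u2, jet2 u 0 u1 u2 /\ b1 = (a1 * u1)%C /\ b2 = (a1 * u2 + a2 * (u1 * u1))%C.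
Proof.
  intros Ha Hf Hu [l Du] Hfu.
  assert (Cu := is_Cderive_continuous _ _ _ Du).
  assert (E0 : b0 = a0).
  { rewrite <- (jet2_0 _ _ _ _ Hfu), Hu. apply (jet2_0 _ _ _ _ Hf). }
  assert (J : exists u1 u2, jet2 u 0 u1 u2).
  { apply is_Cderive_slope in Du. destruct Du as (q & Cq & _ & Q).
    destruct Hf as (h & Ch & <- & H). destruct Hfu as (k & Ck & <- & K).
    subst b0.
    exists (b1 * / a1)%C, ((k (RtoC 0) - q (RtoC 0) ^ 2 * h (u (RtoC 0))) * / a1)%C.
    exists (fun z => (k z - q z ^ 2 * h (u z)) * / a1)%C.
    split; [ | split; [ reflexivity | ] ].
    - cont. apply continuous_comp; [ exact Cu | rewrite Hu; exact Ch ].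
    - assert (Hl : locally (RtoC 0) (fun z : C => f (u z) = (a0 + a1 * u z + u z ^ 2 * h (u z))%C)).
      { apply (Cu (fun w : C => f w = (a0 + a1 * w + w ^ 2 * h w)%C)). rewrite Hu. exact H. }
      generalize (filter_and _ _ (filter_and _ _ Hl K) Q). apply filter_imp.
      intros z [[E1 E2] E3]. rewrite Hu in E3.
      assert (E : (a1 * u z = b1 * z + z ^ 2 * k z - u z ^ 2 * h (u z))%C).
      { apply (Cplus_cancel_l (a0 + u z ^ 2 * h (u z))%C).
        transitivity (f (u z)); [ rewrite E1 | rewrite E2 ]; ring. }
      replace (u z) with (/ a1 * (a1 * u z))%C at 1 by (field; auto).
      rewrite E. replace (u z ^ 2)%C with (z ^ 2 * q z ^ 2)%C by (rewrite E3; ring).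
      ring. }
  destruct J as (u1 & u2 & J). exists u1, u2. split; [ exact J | ].
  apply (jet2_unique _ _ _ _ _ _ _ Hfu (jet2_comp _ _ _ _ _ _ _ Hf J)).
Qed.

(** * Power series on the unit disk *)

Notation is_Cseries := (is_series (K := C_AbsRing) (V := C_NormedModule)).

Lemma is_pseries_Cpow (a : nat -> C) (z l : C) :
  is_pseries (K := C_AbsRing) (V := C_NormedModule) a z l <->
  is_Cseries (fun n => (a n * z ^ n)%C) l.
Proof.
  assert (E : forall n, scal (pow_n (z : C_AbsRing) n) (a n : C_NormedModule) = (a n * z ^ n)%C).
  { intros n.
    assert (P : pow_n (z : C_AbsRing) n = (z ^ n)%C).
    { induction n as [|n IH]; [ reflexivity | ]. simpl. rewrite IH. reflexivity. }
    rewrite P. apply Cmult_comm. }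
  split; apply is_series_ext; intros n; [ | symmetry ]; apply E.
Qed.

Lemma is_series_Cmod_le (u : nat -> C) (b : nat -> R) (l : C) (K : R) :
  is_Cseries u l -> is_series b K -> (forall n, Cmod (u n) <= b n) -> Cmod l <= K.
Proof.
  intros Hu Hb Hle.
  apply (is_lim_seq_le (fun n => Cmod (sum_n (G := C_NormedModule) u n)) (sum_n b)
           (Cmod l) K).
  - intros n. apply Rle_trans with (sum_n (fun k => Cmod (u k)) n).
    + exact (norm_sum_n_m (K := C_AbsRing) (V := C_NormedModule) u 0 n).
    + apply sum_n_m_le, Hle.
  - apply filterlim_comp with (1 := Hu).
    exact (filterlim_norm (K := C_AbsRing) (V := C_NormedModule) l).
  - exact Hb.
Qed.

(** The terms with index at least [N] are bounded by 1 by the Cauchy criterion;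
    the others are finitely many. *)
Lemma is_Cseries_terms_bounded (u : nat -> C) (l : C) :
  is_Cseries u l -> exists M, forall n, Cmod (u n) <= M.
Proof.
  intros Hu.
  destruct (Cauchy_ex_series (V := C_CompleteNormedModule) u (ex_intro _ l Hu) (mkposreal 1 Rlt_0_1))
    as [N HN].
  assert (Hind : forall m, exists M, forall n, (n < m)%nat -> Cmod (u n) <= M).
  { induction m as [|m [M HM]].
    - exists 0. intros n Hn. lia.
    - exists (Rmax M (Cmod (u m))). intros n Hn.
      destruct (PeanoNat.Nat.eq_dec n m) as [->|Hnm]; [ apply Rmax_r | ].
      apply Rle_trans with (2 := Rmax_l _ _). apply HM. lia. }
  destruct (Hind N) as [M HM].
  exists (Rmax M 1). intros n. destruct (Compare_dec.le_lt_dec N n) as [Hn|Hn].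
  - apply Rle_trans with (2 := Rmax_r _ _). apply Rlt_le.
    specialize (HN n n Hn Hn).
    rewrite sum_n_n in HN. exact HN.
  - apply Rle_trans with (2 := Rmax_l _ _). auto.
Qed.

Lemma is_Cseries_unique (u : nat -> C) (l l' : C) :
  is_Cseries u l -> is_Cseries u l' -> l = l'.
Proof.
  exact (filterlim_locally_unique (V := C_NormedModule) (sum_n (G := C_NormedModule) u) l l').
Qed.

Lemma is_Cseries_0 : is_Cseries (fun _ => RtoC 0) (RtoC 0).
Proof.
  apply filterlim_ext with (fun _ => RtoC 0); [ | apply filterlim_const ].
  intros n. symmetry. exact (sum_n_m_const_zero (G := C_NormedModule) 0 n).
Qed.

(** Convergence at a point of modulus [s] with [|r| < s < 1] bounds
    [|a n| s^n], so the real series of moduli has radius of convergence at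
    least [s]. *)
Lemma taylor_CV_radius (f : C -> C) (a : nat -> C) (r : R) :
  taylor_expansion f a -> Rabs r < 1 ->
  Rbar_lt (Rabs r) (CV_radius (fun n => Cmod (a n))).
Proof.
  intros Hf Hr. set (s := (1 + Rabs r) / 2).
  assert (H0 := Rabs_pos r).
  apply Rbar_lt_le_trans with s; [ simpl; unfold s; lra | ].
  apply CV_radius_bounded.
  assert (Hs : Cmod s = s) by (rewrite Cmod_R; apply Rabs_pos_eq; unfold s; lra).
  assert (Hd : disk s) by (unfold disk; rewrite Hs; unfold s; lra).
  destruct (is_Cseries_terms_bounded _ _ (proj1 (is_pseries_Cpow _ _ _) (Hf _ Hd))) as [M HM].
  exists M. intros n. specialize (HM n).
  rewrite Cmod_mult, Cmod_pow, Hs in HM.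
  rewrite Rabs_pos_eq; [ exact HM | ].
  apply Rmult_le_pos; [ apply Cmod_ge_0 | apply pow_le; unfold s; lra ].
Qed.

Definition Cderive_coef (a : nat -> C) (n : nat) : C := (INR (S n) * a (S n))%C.

(** Multiplying the remainder of the first-order expansion of [(z + h)^m] by
    [z + h] leaves an error [m z^(m-1) h^2] for the exponent [m + 1]. *)
Lemma pow_diff_bound (z h : C) (r : R) (n : nat) :
  Cmod z <= r -> Cmod (z + h)%C <= r ->
  Cmod ((z + h) ^ S (S n) - z ^ S (S n) - h * (INR (S (S n)) * z ^ S n))%C
  <= INR (S (S n)) * INR (S n) * r ^ n * Cmod h ^ 2.
Proof.
  intros Hz Hzh.
  assert (Hr : 0 <= r) by (apply Rle_trans with (2 := Hz), Cmod_ge_0).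
  induction n as [|n IH].
  - replace ((z + h) ^ 2 - z ^ 2 - h * (INR 2 * z ^ 1))%C with (h ^ 2)%C
      by (simpl; rewrite RtoC_plus; ring).
    rewrite Cmod_pow. simpl. assert (T := Cmod_ge_0 h). nra.
  - set (m := S (S n)) in *.
    replace ((z + h) ^ S m - z ^ S m - h * (INR (S m) * z ^ m))%C
      with ((z + h) * ((z + h) ^ m - z ^ m - h * (INR m * z ^ S n))
            + INR m * z ^ S n * h ^ 2)%C
      by (rewrite (S_INR m), RtoC_plus; generalize (INR m); intros x;
          unfold m; cbn [Cpow]; ring).
    apply Rle_trans with (1 := Cmod_triangle _ _).
    rewrite !Cmod_mult, !Cmod_pow, Cmod_R.
    rewrite (Rabs_pos_eq (INR m)) by apply pos_INR.
    assert (P : Cmod z ^ S n <= r ^ S n)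
      by (apply pow_incr; split; [ apply Cmod_ge_0 | exact Hz ]).
    assert (Q := pow_le _ n Hr).
    assert (T := pow2_ge_0 (Cmod h)).
    assert (N1 := pos_INR n).
    assert (I1 : INR (S n) = INR n + 1) by apply S_INR.
    assert (I2 : INR m = INR n + 2) by (unfold m; rewrite !S_INR; ring).
    rewrite (S_INR m), I2. rewrite I1, I2 in IH.
    apply Rle_trans with (r * ((INR n + 2) * (INR n + 1) * r ^ n * Cmod h ^ 2)
                          + (INR n + 2) * r ^ S n * Cmod h ^ 2).
    + apply Rplus_le_compat.
      * apply Rmult_le_compat; auto; apply Cmod_ge_0.
      * apply Rmult_le_compat_r; auto. apply Rmult_le_compat_l; lra.
    + simpl (r ^ S n).
      assert (0 <= r * r ^ n * Cmod h ^ 2) by (apply Rmult_le_pos; [ apply Rmult_le_pos | ]; auto).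
      nra.
Qed.

(** Termwise differentiation. The remainder of order [h^2] is dominated by the
    twice differentiated series of moduli, whose radius of convergence is that
    of the series of moduli. *)
Lemma taylor_is_Cderive (f : C -> C) (a : nat -> C) (z : C) :
  taylor_expansion f a -> disk z ->
  exists l, is_Cderive f z l /\
    is_pseries (K := C_AbsRing) (V := C_NormedModule) (Cderive_coef a) z l.
Proof.
  intros Hf Hz. unfold disk in Hz.
  set (A := fun n => Cmod (a n)).
  assert (HA1 : forall r, Rabs r < 1 -> ex_series (fun n => Rabs (PS_derive A n * r ^ n))).
  { intros r Hr. apply CV_disk_inside. rewrite CV_radius_derive.
    apply (taylor_CV_radius f a); auto. }
  assert (HA2 : forall r, Rabs r < 1 -> ex_series (fun n => Rabs (PS_derive (PS_derive A) n * r ^ n))).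
  { intros r Hr. apply CV_disk_inside. rewrite !CV_radius_derive.
    apply (taylor_CV_radius f a); auto. }
  assert (Hz0 := Cmod_ge_0 z).
  assert (Hl : exists l : C, is_Cseries (fun n => (Cderive_coef a n * z ^ n)%C) l).
  { apply (ex_series_le (V := C_CompleteNormedModule) _
             (fun n => Rabs (PS_derive A n * Cmod z ^ n))).
    - intros n. change (Cmod (Cderive_coef a n * z ^ n) <= Rabs (PS_derive A n * Cmod z ^ n)).
      unfold Cderive_coef, PS_derive, A.
      rewrite Rabs_pos_eq.
      + rewrite !Cmod_mult, Cmod_pow, Cmod_R, (Rabs_pos_eq (INR (S n))) by apply pos_INR.
        apply Rle_refl.
      + repeat apply Rmult_le_pos; [ apply pos_INR | apply Cmod_ge_0 | apply pow_le; auto ].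
    - apply HA1. rewrite Rabs_pos_eq; auto. }
  destruct Hl as [l Hl]. exists l. split; [ | apply is_pseries_Cpow; exact Hl ].
  (* Any radius strictly between [|z|] and 1 leaves room for the increment. *)
  set (r := (1 + Cmod z) / 2).
  assert (Hr : Rabs r < 1) by (rewrite Rabs_pos_eq; unfold r; lra).
  destruct (HA2 r Hr) as [K HK].
  apply is_Cderive_eps. intros eps.
  assert (HK0 : 0 <= K).
  { rewrite <- Cmod_0. apply (is_series_Cmod_le _ _ _ _ is_Cseries_0 HK).
    intros n. rewrite Cmod_0. apply Rabs_pos. }
  assert (Hd : 0 < Rmin (r - Cmod z) (eps / (K + 1))).
  { apply Rmin_glb_lt; [ unfold r; lra | ].
    apply Rdiv_lt_0_compat; [ apply eps | lra ]. }
  exists (mkposreal _ Hd). simpl. intros y Hy.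
  set (h := (y - z)%C) in *.
  assert (Ey : y = (z + h)%C) by (unfold h; ring).
  assert (Hh1 := Rlt_le_trans _ _ _ Hy (Rmin_l _ _)).
  assert (Hh2 := Rlt_le_trans _ _ _ Hy (Rmin_r _ _)).
  assert (Hyr : Cmod y <= r).
  { rewrite Ey. apply Rle_trans with (1 := Cmod_triangle _ _). lra. }
  assert (S1 : is_Cseries (fun n => (a n * y ^ n)%C) (f y)).
  { apply is_pseries_Cpow, Hf. unfold disk. unfold r in Hyr. lra. }
  assert (S2 : is_Cseries (fun n => (a n * z ^ n)%C) (f z)).
  { apply is_pseries_Cpow, Hf. exact Hz. }
  (* The derived series shifted by one index, to be subtracted termwise. *)
  set (dz := fun n => match n with O => RtoC 0 | S m => (Cderive_coef a m * z ^ m)%C end).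
  assert (S3 : is_Cseries dz l).
  { apply (is_series_decr_1 (V := C_NormedModule) dz).
    change (is_Cseries (fun k => (Cderive_coef a k * z ^ k)%C) (l - 0)%C).
    replace (l - 0)%C with l by ring. exact Hl. }
  set (t := fun n => (a n * y ^ n - a n * z ^ n - h * dz n)%C).
  assert (S4 : is_Cseries t (f y - f z - h * l)%C).
  { exact (is_series_minus (V := C_NormedModule) _ _ _ _
             (is_series_minus (V := C_NormedModule) _ _ _ _ S1 S2)
             (is_series_scal (V := C_NormedModule) h _ _ S3)). }
  assert (t0 : t 0%nat = 0%C) by (unfold t, dz; simpl; ring).
  assert (t1 : t 1%nat = 0%C).
  { unfold t, dz, Cderive_coef, h. simpl. ring. }
  assert (S5 : is_Cseries (fun n => t (S (S n))) (f y - f z - h * l)%C).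
  { apply (is_series_incr_1 (V := C_NormedModule) (fun n => t (S n))).
    apply (is_series_incr_1 (V := C_NormedModule) t).
    rewrite t0, t1.
    change (is_Cseries t (f y - f z - h * l + 0 + 0)%C).
    replace (f y - f z - h * l + 0 + 0)%C with (f y - f z - h * l)%C by ring.
    exact S4. }
  assert (B : Cmod (f y - f z - h * l)%C <= K * Cmod h ^ 2).
  { apply (is_series_Cmod_le _ (fun n => Rabs (PS_derive (PS_derive A) n * r ^ n) * Cmod h ^ 2) _ _ S5).
    - apply is_series_scal_r. exact HK.
    - intros n.
      replace (t (S (S n))) with
        (a (S (S n)) * ((z + h) ^ S (S n) - z ^ S (S n) - h * (INR (S (S n)) * z ^ S n)))%C
        by (unfold t, dz, Cderive_coef; rewrite Ey; ring).
      rewrite Cmod_mult.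
      apply Rle_trans with (Cmod (a (S (S n))) * (INR (S (S n)) * INR (S n) * r ^ n * Cmod h ^ 2)).
      + apply Rmult_le_compat_l; [ apply Cmod_ge_0 | ].
        apply pow_diff_bound; [ unfold r; lra | rewrite <- Ey; exact Hyr ].
      + unfold PS_derive, A. rewrite Rabs_pos_eq.
        * apply Req_le. ring.
        * repeat apply Rmult_le_pos; try apply pos_INR; [ apply Cmod_ge_0 | ].
          apply pow_le. unfold r; lra. }
  apply Rle_trans with (1 := B).
  simpl. rewrite Rmult_1_r, <- Rmult_assoc.
  apply Rmult_le_compat_r; [ apply Cmod_ge_0 | ].
  apply Rle_trans with ((K + 1) * (eps / (K + 1))).
  - apply Rmult_le_compat; try lra; apply Cmod_ge_0.
  - apply Req_le. field. lra.
Qed.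

Lemma taylor_C_derive (f : C -> C) (a : nat -> C) :
  taylor_expansion f a -> taylor_expansion (C_derive f) (Cderive_coef a).
Proof.
  intros Hf z Hz. destruct (taylor_is_Cderive f a z Hf Hz) as (l & Hl & Hs).
  rewrite (is_C_derive_unique _ _ _ Hl). exact Hs.
Qed.

Lemma taylor_is_C_derive (f : C -> C) (a : nat -> C) (z : C) :
  taylor_expansion f a -> disk z -> is_Cderive f z (C_derive f z).
Proof.
  intros Hf Hz. destruct (taylor_is_Cderive f a z Hf Hz) as (l & Hl & _).
  rewrite (is_C_derive_unique _ _ _ Hl). exact Hl.
Qed.

Lemma disk_0 : disk 0%C.
Proof. unfold disk. rewrite Cmod_0. lra. Qed.

Lemma taylor_continuous_0 (f : C -> C) (a : nat -> C) :
  taylor_expansion f a -> continuous f (RtoC 0).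
Proof.
  intros Hf. apply (is_Cderive_continuous f (RtoC 0) (C_derive f (RtoC 0))).
  apply (taylor_is_C_derive f a); [ exact Hf | apply disk_0 ].
Qed.

Lemma taylor_at_0 (f : C -> C) (a : nat -> C) :
  taylor_expansion f a -> f 0%C = a 0%nat.
Proof.
  intros Hf.
  apply (is_Cseries_unique (fun n => (a n * 0 ^ n)%C)).
  - apply is_pseries_Cpow, Hf, disk_0.
  - apply (is_series_decr_1 (V := C_NormedModule) (fun n => (a n * 0 ^ n)%C)).
    change (is_Cseries (fun k => (a (S k) * 0 ^ S k)%C) (a 0%nat - a 0%nat * 1)%C).
    replace (a 0%nat - a 0%nat * 1)%C with (RtoC 0) by ring.
    apply is_series_ext with (2 := is_Cseries_0).
    intros k. change (RtoC 0 = a (S k) * (0 * 0 ^ k))%C. ring.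
Qed.

Definition quotient0 (f : C -> C) (c z : C) : C :=
  if Ceq_dec z 0%C then c else ((f z - f 0%C) / z)%C.

Lemma quotient0_eq (f : C -> C) (c z : C) : f z = (f 0%C + z * quotient0 f c z)%C.
Proof.
  unfold quotient0. destruct (Ceq_dec z 0%C) as [->|Hz]; [ ring | field; auto ].
Qed.

(** The difference quotient at the origin is again a power series, hence
    continuous; this is what turns a power series into a [jet2]. *)
Lemma taylor_shift (f : C -> C) (a : nat -> C) :
  taylor_expansion f a -> taylor_expansion (quotient0 f (a 1%nat)) (fun n => a (S n)).
Proof.
  intros Hf z Hz. unfold quotient0. destruct (Ceq_dec z 0%C) as [->|Hz0].
  - destruct (taylor_is_Cderive f a 0%C Hf disk_0) as (l & Hl & _).
    apply is_pseries_Cpow.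
    apply (is_series_decr_1 (V := C_NormedModule) (fun n => (a (S n) * 0 ^ n)%C)).
    change (is_Cseries (fun k => (a (S (S k)) * 0 ^ S k)%C) (a 1%nat - a 1%nat * 1)%C).
    replace (a 1%nat - a 1%nat * 1)%C with (RtoC 0) by ring.
    apply is_series_ext with (2 := is_Cseries_0).
    intros k. change (RtoC 0 = a (S (S k)) * (0 * 0 ^ k))%C. ring.
  - assert (Hs := proj1 (is_pseries_Cpow _ _ _) (Hf z Hz)).
    rewrite (taylor_at_0 f a Hf).
    apply is_pseries_Cpow.
    assert (H1 : is_Cseries (fun n => (a (S n) * z ^ S n)%C) (f z - a 0%nat)%C).
    { apply (is_series_incr_1 (V := C_NormedModule) (fun n => (a n * z ^ n)%C)).
      change (is_Cseries (fun n => (a n * z ^ n)%C) (f z - a 0%nat + a 0%nat * z ^ 0)%C).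
      replace (f z - a 0%nat + a 0%nat * z ^ 0)%C with (f z) by (simpl; ring).
      exact Hs. }
    apply (is_series_scal (V := C_NormedModule) (/ z)%C) in H1.
    replace ((f z - a 0%nat) / z)%C with (/ z * (f z - a 0%nat))%C by (field; auto).
    revert H1. apply is_series_ext. intros n.
    change (/ z * (a (S n) * (z * z ^ n)) = a (S n) * z ^ n)%C. field. auto.
Qed.

Lemma taylor_jet2 (f : C -> C) (a : nat -> C) :
  taylor_expansion f a -> jet2 f (a 0%nat) (a 1%nat) (a 2%nat).
Proof.
  intros Hf. assert (Hr := taylor_shift f a Hf).
  set (r := quotient0 f (a 1%nat)) in *.
  assert (Hh := taylor_shift r _ Hr). simpl in Hh.
  set (h := quotient0 r (a 2%nat)) in *.
  exists h. split; [ apply (taylor_continuous_0 h _ Hh) | ].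
  split; [ apply (taylor_at_0 h _ Hh) | ].
  apply filter_forall. intros z.
  rewrite (quotient0_eq f (a 1%nat) z). fold r.
  rewrite (quotient0_eq r (a 2%nat) z). fold h.
  rewrite (taylor_at_0 f a Hf), (taylor_at_0 r _ Hr). ring.
Qed.

(** * The exponential map and integrals over rectangles *)

Definition cexp (z : C) : C := (exp (Re z) * cos (Im z), exp (Re z) * sin (Im z)).

Lemma Cmod_le_abs (x y : R) : Cmod (x, y) <= Rabs x + Rabs y.
Proof.
  replace ((x, y) : C) with (x + Ci * y)%C.
  - apply Rle_trans with (1 := Cmod_triangle _ _).
    rewrite Cmod_mult, Cmod_Ci, !Cmod_R. lra.
  - unfold Ci, RtoC, Cplus, Cmult; simpl. f_equal; ring.
Qed.

Lemma Im_le_Cmod (z : C) : Rabs (Im z) <= Cmod z.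
Proof. apply Rle_trans with (2 := Rmax_Cmod z), Rmax_r. Qed.

Lemma cexp_plus (z w : C) : cexp (z + w) = (cexp z * cexp w)%C.
Proof.
  destruct z as [x y], w as [u v]. unfold cexp, Cmult; simpl.
  rewrite exp_plus, cos_plus, sin_plus. f_equal; ring.
Qed.

Lemma derive_eps (f : R -> R) (l : R) :
  is_derive f 0 l -> forall eps : posreal, exists d : posreal, forall y,
    Rabs y < d -> Rabs (f y - f 0 - y * l) <= eps * Rabs y.
Proof.
  intros [_ H] eps. destruct (H 0 (fun P HP => HP) eps) as [d Hd].
  exists d. intros y Hy. specialize (Hd y).
  assert (B : ball 0 d y) by (change (Rabs (y - 0) < d); rewrite Rminus_0_r; exact Hy).
  specialize (Hd B). change (Rabs (f y - f 0 - (y - 0) * l) <= eps * Rabs (y - 0)) in Hd.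
  rewrite Rminus_0_r in Hd. exact Hd.
Qed.

(** With [ex], [cy], [sy] the first-order remainders of [exp], [cos], [sin],
    the remainder of [cexp] at [x + iy] is
    [(ex cos y + (1 + x) cy) + i ((x + ex) sin y + sy)]. *)
Lemma is_Cderive_cexp_0 : is_Cderive cexp (RtoC 0) (RtoC 1).
Proof.
  apply is_Cderive_eps. intros eps.
  (* The estimate below adds up seven contributions of size [e |h|]. *)
  assert (He : 0 < Rmin (eps / 7) 1) by (apply Rmin_glb_lt; [ assert (h := cond_pos eps) | ]; lra).
  set (e := mkposreal _ He).
  assert (He1 : e <= 1) by apply Rmin_r.
  assert (He6 : e <= eps / 7) by apply Rmin_l.
  assert (De : is_derive exp 0 1) by (auto_derive; [ auto | rewrite exp_0; ring ]).
  assert (Dc : is_derive cos 0 0) by (auto_derive; [ auto | rewrite sin_0; ring ]).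
  assert (Ds : is_derive sin 0 1) by (auto_derive; [ auto | rewrite cos_0; ring ]).
  destruct (derive_eps _ _ De e) as [d1 H1].
  destruct (derive_eps _ _ Dc e) as [d2 H2].
  destruct (derive_eps _ _ Ds e) as [d3 H3].
  rewrite exp_0 in H1. rewrite cos_0 in H2. rewrite sin_0 in H3.
  assert (Hd : 0 < Rmin (Rmin d1 d2) (Rmin d3 e)).
  { apply Rmin_glb_lt; apply Rmin_glb_lt; apply cond_pos. }
  exists (mkposreal _ Hd). simpl. intros [x y] Hh.
  set (m := Cmod ((x, y) - 0)%C) in *.
  assert (Em : m = Cmod (x, y)).
  { unfold m. f_equal. ring. }
  assert (Hx : Rabs x <= m) by (rewrite Em; exact (re_le_Cmod (x, y))).
  assert (Hy : Rabs y <= m) by (rewrite Em; exact (Im_le_Cmod (x, y))).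
  assert (A1 := Rlt_le_trans _ _ _ Hh (Rmin_l _ _)).
  assert (A2 := Rlt_le_trans _ _ _ Hh (Rmin_r _ _)).
  assert (B1 := Rlt_le_trans _ _ _ A1 (Rmin_l _ _)).
  assert (B2 := Rlt_le_trans _ _ _ A1 (Rmin_r _ _)).
  assert (B3 := Rlt_le_trans _ _ _ A2 (Rmin_l _ _)).
  assert (B4 := Rlt_le_trans _ _ _ A2 (Rmin_r _ _)).
  assert (B5 : m <= e) by (apply Rlt_le; exact B4).
  specialize (H1 x). specialize (H2 y). specialize (H3 y).
  assert (C1 : Rabs (exp x - 1 - x * 1) <= e * Rabs x) by (apply H1; lra).
  assert (C2 : Rabs (cos y - 1 - y * 0) <= e * Rabs y) by (apply H2; lra).
  assert (C3 : Rabs (sin y - 0 - y * 1) <= e * Rabs y) by (apply H3; lra).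
  clear H1 H2 H3.
  set (ex := exp x - 1 - x * 1) in *. set (cy := cos y - 1 - y * 0) in *.
  set (sy := sin y - 0 - y * 1) in *.
  assert (Px := Rabs_pos x). assert (Py := Rabs_pos y).
  assert (Pe := cond_pos e).
  replace (cexp (x, y) - cexp 0 - ((x, y) - 0) * 1)%C with
    ((ex * cos y + (1 + x) * cy, (x + ex) * sin y + sy) : C).
  2:{ unfold cexp, Cminus, Cplus, Copp, Cmult, RtoC; simpl.
      rewrite exp_0, cos_0, sin_0. unfold ex, cy, sy. f_equal; ring. }
  apply Rle_trans with (1 := Cmod_le_abs _ _).
  assert (Q1 : Rabs (cos y) <= 1) by (apply Rabs_le; apply COS_bound).
  assert (Q2 : Rabs (sin y) <= 1) by (apply Rabs_le; apply SIN_bound).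
  assert (Q3 : Rabs (sin y) <= 2 * Rabs y).
  { replace (sin y) with (y + sy) by (unfold sy; ring).
    apply Rle_trans with (1 := Rabs_triang _ _). nra. }
  assert (R1 : Rabs (ex * cos y + (1 + x) * cy) <= e * Rabs x + 2 * (e * Rabs y)).
  { apply Rle_trans with (1 := Rabs_triang _ _). rewrite !Rabs_mult.
    assert (Rabs (1 + x) <= 2).
    { apply Rle_trans with (1 := Rabs_triang _ _).
      rewrite (Rabs_pos_eq 1); lra. }
    assert (T1 := Rabs_pos ex). assert (T2 := Rabs_pos cy).
    assert (T3 := Rabs_pos (1 + x)). assert (T4 := Rabs_pos (cos y)). nra. }
  assert (R2 : Rabs ((x + ex) * sin y + sy) <= e * (2 * m) + e * Rabs x + e * Rabs y).
  { apply Rle_trans with (1 := Rabs_triang _ _). rewrite Rabs_mult.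
    assert (Rabs (x + ex) <= Rabs x + e * Rabs x).
    { apply Rle_trans with (1 := Rabs_triang _ _). lra. }
    assert (T1 := Rabs_pos (x + ex)). assert (T4 := Rabs_pos (sin y)).
    assert (Rabs (x + ex) * Rabs (sin y) <= (Rabs x + e * Rabs x) * Rabs (sin y))
      by (apply Rmult_le_compat_r; lra).
    assert (Rabs x * Rabs (sin y) <= e * (2 * m)).
    { apply Rle_trans with (e * (2 * Rabs y)); [ apply Rmult_le_compat; lra | ].
      apply Rmult_le_compat_l; lra. }
    assert (e * Rabs x * Rabs (sin y) <= e * Rabs x * 1)
      by (apply Rmult_le_compat_l; [ apply Rmult_le_pos; lra | lra ]).
    lra. }
  assert (Pm : 0 <= m) by lra.
  assert (e * Rabs x <= e * m) by (apply Rmult_le_compat_l; lra).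
  assert (e * Rabs y <= e * m) by (apply Rmult_le_compat_l; lra).
  assert (e * m <= eps / 7 * m) by (apply Rmult_le_compat_r; lra).
  lra.
Qed.

Lemma is_Cderive_cexp (z : C) : is_Cderive cexp z (cexp z).
Proof.
  apply (is_derive_ext (V := C_NormedModule) (fun y => (cexp z * cexp (y - z))%C)).
  { intros y. rewrite <- cexp_plus. f_equal. ring. }
  assert (H := is_Cderive_mult (fun _ => cexp z) (fun y => cexp (y - z)%C) z 0%C 1%C).
  cbv beta in H.
  replace (0 * cexp (z - z) + cexp z * 1)%C with (cexp z) in H by ring.
  apply H; [ apply is_Cderive_const | ].
  replace (RtoC 1) with ((1 - 0) * 1)%C by ring.
  apply (is_Cderive_comp cexp (fun y => (y - z)%C)).
  - replace (z - z)%C with (RtoC 0) by ring. apply is_Cderive_cexp_0.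
  - apply (is_Cderive_minus (fun y => y) (fun _ => z));
      [ apply is_Cderive_id | apply is_Cderive_const ].
Qed.

Lemma Cmod_cexp (z : C) : Cmod (cexp z) = exp (Re z).
Proof.
  unfold Cmod, cexp; simpl fst; simpl snd.
  replace ((exp (Re z) * cos (Im z)) ^ 2 + (exp (Re z) * sin (Im z)) ^ 2)
    with (exp (Re z) ^ 2 * (Rsqr (sin (Im z)) + Rsqr (cos (Im z))))
    by (unfold Rsqr; ring).
  rewrite sin2_cos2, Rmult_1_r. apply sqrt_pow2. apply Rlt_le, exp_pos.
Qed.

Notation CInt := (RInt (V := C_R_CompleteNormedModule)).
Notation is_CInt := (is_RInt (V := C_R_NormedModule)).

Lemma continuous_horizontal (k : C -> C) (x c : R) :
  continuous k ((x, c) : C) -> continuous (fun t : R => k (t, c)) x.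
Proof.
  intros H. apply (continuous_comp (fun t : R => ((t, c) : C)) k x); [ | exact H ].
  intros P HP. apply locally_Cmod in HP. destruct HP as [d Hd].
  exists d. intros y Hy. apply Hd.
  apply Rle_lt_trans with (Rabs (y - x)); [ | exact Hy ].
  assert (E : (((y, c) : C) - ((x, c) : C) = RtoC (y - x))%C).
  { apply injective_projections; simpl; ring. }
  change (Cmod (((y, c) : C) - ((x, c) : C))%C <= Rabs (y - x)).
  rewrite E, Cmod_R. apply Rle_refl.
Qed.

Lemma continuous_vertical (k : C -> C) (x c : R) :
  continuous k ((x, c) : C) -> continuous (fun t : R => k (x, t)) c.
Proof.
  intros H. apply (continuous_comp (fun t : R => ((x, t) : C)) k c); [ | exact H ].
  intros P HP. apply locally_Cmod in HP. destruct HP as [d Hd].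
  exists d. intros y Hy. apply Hd.
  apply Rle_lt_trans with (Rabs (y - c)); [ | exact Hy ].
  assert (E : (((x, y) : C) - ((x, c) : C) = Ci * RtoC (y - c))%C).
  { apply injective_projections; simpl; ring. }
  change (Cmod (((x, y) : C) - ((x, c) : C))%C <= Rabs (y - c)).
  rewrite E, Cmod_mult, Cmod_Ci, Cmod_R, Rmult_1_l. apply Rle_refl.
Qed.

(** The integral of [k] along the boundary of the rectangle
    [[a, b] x [c, d]], counterclockwise. *)
Definition boundary (k : C -> C) (a b c d : R) : C :=
  (CInt (fun x => k (x, c)) a b + Ci * CInt (fun y => k (b, y)) c d
   - CInt (fun x => k (x, d)) a b - Ci * CInt (fun y => k (a, y)) c d)%C.

Definition continuous_on_rect (k : C -> C) (a b c d : R) : Prop :=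
  forall x y, a <= x <= b -> c <= y <= d -> continuous k ((x, y) : C).

Lemma continuous_on_rect_sub k a b c d a' b' c' d' :
  continuous_on_rect k a b c d -> a <= a' -> b' <= b -> c <= c' -> d' <= d ->
  continuous_on_rect k a' b' c' d'.
Proof. intros H ? ? ? ? x y Hx Hy. apply H; lra. Qed.

Lemma ex_CInt_horizontal k a b c d y :
  continuous_on_rect k a b c d -> a <= b -> c <= y <= d ->
  ex_RInt (V := C_R_CompleteNormedModule) (fun x => k (x, y)) a b.
Proof.
  intros H Hab Hy. apply (ex_RInt_continuous (V := C_R_CompleteNormedModule)).
  intros x. rewrite Rmin_left, Rmax_right by exact Hab. intros Hx.
  apply (continuous_horizontal k x y), H; auto.
Qed.

Lemma ex_CInt_vertical k a b c d x :
  continuous_on_rect k a b c d -> c <= d -> a <= x <= b ->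
  ex_RInt (V := C_R_CompleteNormedModule) (fun y => k (x, y)) c d.
Proof.
  intros H Hab Hy. apply (ex_RInt_continuous (V := C_R_CompleteNormedModule)).
  intros y. rewrite Rmin_left, Rmax_right by exact Hab. intros Hx.
  apply (continuous_vertical k x y), H; auto.
Qed.

Lemma CInt_split_h k a b c d m y :
  continuous_on_rect k a b c d -> a <= m <= b -> c <= y <= d ->
  CInt (fun x => k (x, y)) a b
  = (CInt (fun x => k (x, y)) a m + CInt (fun x => k (x, y)) m b)%C.
Proof.
  intros H Hm Hy. symmetry. apply (RInt_Chasles (V := C_R_CompleteNormedModule)).
  - apply (ex_CInt_horizontal k a m c d); try lra.
    apply (continuous_on_rect_sub k a b c d); lra || auto.
  - apply (ex_CInt_horizontal k m b c d); try lra.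
    apply (continuous_on_rect_sub k a b c d); lra || auto.
Qed.

Lemma CInt_split_v k a b c d x n :
  continuous_on_rect k a b c d -> a <= x <= b -> c <= n <= d ->
  CInt (fun y => k (x, y)) c d
  = (CInt (fun y => k (x, y)) c n + CInt (fun y => k (x, y)) n d)%C.
Proof.
  intros H Hm Hy. symmetry. apply (RInt_Chasles (V := C_R_CompleteNormedModule)).
  - apply (ex_CInt_vertical k a b c n); try lra.
    apply (continuous_on_rect_sub k a b c d); lra || auto.
  - apply (ex_CInt_vertical k a b n d); try lra.
    apply (continuous_on_rect_sub k a b c d); lra || auto.
Qed.

Lemma boundary_split k a b c d m n :
  continuous_on_rect k a b c d -> a <= m <= b -> c <= n <= d ->
  boundary k a b c d
  = (boundary k a m c n + boundary k m b c n + boundary k a m n d + boundary k m b n d)%C.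
Proof.
  intros H Hm Hn. unfold boundary.
  rewrite (CInt_split_h k a b c d m c), (CInt_split_h k a b c d m d),
    (CInt_split_v k a b c d a n), (CInt_split_v k a b c d b n) by (auto || lra).
  ring.
Qed.

Lemma is_CInt_affine (p q : C) (a b : R) :
  is_CInt (fun t => (p + t * q)%C) a b ((b - a) * p + (b ^ 2 - a ^ 2) / 2 * q)%C.
Proof.
  assert (Hr : forall u v : R, is_RInt (fun t => u + t * v) a b
                                 ((b - a) * u + (b ^ 2 - a ^ 2) / 2 * v)).
  { intros u v.
    replace ((b - a) * u + (b ^ 2 - a ^ 2) / 2 * v)
      with (minus (u * b + v * b ^ 2 / 2) (u * a + v * a ^ 2 / 2))
      by (unfold minus, plus, opp; simpl; field).
    apply (is_RInt_derive (fun t => u * t + v * t ^ 2 / 2)).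
    - intros x _. auto_derive; [ auto | field ].
    - intros x _. apply (ex_derive_continuous (fun t => u + t * v)). auto_derive. auto. }
  destruct p as [p1 p2], q as [q1 q2].
  replace ((b - a) * (p1, p2) + (b ^ 2 - a ^ 2) / 2 * (q1, q2))%C
    with (((b - a) * p1 + (b ^ 2 - a ^ 2) / 2 * q1,
           (b - a) * p2 + (b ^ 2 - a ^ 2) / 2 * q2) : C).
  - apply is_RInt_fct_extend_pair; simpl.
    + apply is_RInt_ext with (2 := Hr p1 q1). intros x _. simpl. ring.
    + apply is_RInt_ext with (2 := Hr p2 q2). intros x _. simpl. ring.
  - apply injective_projections; simpl; field.
Qed.

Lemma CInt_near_affine (g : R -> C) (p q : C) (a b e : R) :
  a <= b -> ex_RInt (V := C_R_CompleteNormedModule) g a b ->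
  (forall t, a <= t <= b -> Cmod (g t - (p + t * q))%C <= e) ->
  Cmod (CInt g a b - ((b - a) * p + (b ^ 2 - a ^ 2) / 2 * q))%C <= (b - a) * e.
Proof.
  intros Hab Hg He.
  rewrite Cmod_norm.
  apply (norm_RInt_le_const (V := C_R_NormedModule) (fun t => (g t - (p + t * q))%C) a b).
  - exact Hab.
  - intros t Ht. specialize (He t Ht). rewrite Cmod_norm in He. exact He.
  - apply (is_RInt_minus (V := C_R_NormedModule)).
    + exact (RInt_correct (V := C_R_CompleteNormedModule) _ _ _ Hg).
    + apply is_CInt_affine.
Qed.

(** The boundary integral of an affine function vanishes, so only the deviation
    from it contributes, at most [e] times the perimeter. *)
Lemma boundary_near_affine k (z0 l : C) a b c d e :
  a <= b -> c <= d -> continuous_on_rect k a b c d ->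
  (forall x y, a <= x <= b -> c <= y <= d ->
     Cmod (k (x, y) - k z0 - ((x, y) - z0) * l)%C <= e) ->
  Cmod (boundary k a b c d) <= 2 * (b - a + (d - c)) * e.
Proof.
  intros Hab Hcd Ck He. set (p := (k z0 - z0 * l)%C).
  assert (Hh : forall y, c <= y <= d ->
    Cmod (CInt (fun x => k (x, y)) a b
          - ((b - a) * (p + Ci * y * l) + (b ^ 2 - a ^ 2) / 2 * l))%C <= (b - a) * e).
  { intros y Hy. apply CInt_near_affine; [ exact Hab | | ].
    - apply (ex_CInt_horizontal k a b c d); auto.
    - intros t Ht.
      replace (k (t, y) - (p + Ci * y * l + t * l))%C
        with (k (t, y) - k z0 - ((t, y) - z0) * l)%C; [ apply He; auto | ].
      replace ((t, y) : C) with (t + Ci * y)%C at 2; [ unfold p; ring | ].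
      apply injective_projections; simpl; ring. }
  assert (Hv : forall x, a <= x <= b ->
    Cmod (CInt (fun y => k (x, y)) c d
          - ((d - c) * (p + x * l) + (d ^ 2 - c ^ 2) / 2 * (Ci * l)))%C <= (d - c) * e).
  { intros x Hx. apply CInt_near_affine; [ exact Hcd | | ].
    - apply (ex_CInt_vertical k a b c d); auto.
    - intros t Ht.
      replace (k (x, t) - (p + x * l + t * (Ci * l)))%C
        with (k (x, t) - k z0 - ((x, t) - z0) * l)%C; [ apply He; auto | ].
      replace ((x, t) : C) with (x + Ci * t)%C at 2; [ unfold p; ring | ].
      apply injective_projections; simpl; ring. }
  assert (H1 := Hh c ltac:(lra)). assert (H2 := Hv b ltac:(lra)).
  assert (H3 := Hh d ltac:(lra)). assert (H4 := Hv a ltac:(lra)).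
  match type of H1 with Cmod ?u <= _ => set (r1 := u) in * end.
  match type of H2 with Cmod ?u <= _ => set (r2 := u) in * end.
  match type of H3 with Cmod ?u <= _ => set (r3 := u) in * end.
  match type of H4 with Cmod ?u <= _ => set (r4 := u) in * end.
  replace (boundary k a b c d) with (r1 + Ci * r2 - r3 - Ci * r4)%C.
  - unfold Cminus.
    apply Rle_trans with (Cmod r1 + Cmod r2 + Cmod r3 + Cmod r4); [ | lra ].
    apply Rle_trans with (1 := Cmod_triangle _ _).
    rewrite Cmod_opp, Cmod_mult, Cmod_Ci.
    apply Rplus_le_compat; [ | lra ].
    apply Rle_trans with (1 := Cmod_triangle _ _). rewrite Cmod_opp.
    apply Rplus_le_compat_r.
    apply Rle_trans with (1 := Cmod_triangle _ _). rewrite Cmod_mult, Cmod_Ci. lra.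
  - unfold boundary, r1, r2, r3, r4.
    ring.
Qed.

(** * Goursat's theorem on rectangles *)

Lemma nested_point (u v : nat -> R) :
  (forall n, u n <= u (S n)) -> (forall n, v (S n) <= v n) -> (forall n, u n <= v n) ->
  exists x, forall n, u n <= x <= v n.
Proof.
  intros Hu Hv Huv.
  assert (Mu : forall n m, u n <= u (n + m)%nat).
  { intros n m. induction m as [|m IH].
    - rewrite PeanoNat.Nat.add_0_r. lra.
    - rewrite PeanoNat.Nat.add_succ_r. specialize (Hu (n + m)%nat). lra. }
  assert (Mv : forall n m, v (n + m)%nat <= v n).
  { intros n m. induction m as [|m IH].
    - rewrite PeanoNat.Nat.add_0_r. lra.
    - rewrite PeanoNat.Nat.add_succ_r. specialize (Hv (n + m)%nat). lra. }
  assert (Cross : forall n m, u n <= v m).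
  { intros n m. apply Rle_trans with (1 := Mu n m).
    apply Rle_trans with (1 := Huv (n + m)%nat).
    rewrite PeanoNat.Nat.add_comm. apply Mv. }
  destruct (completeness (fun x => exists n, x = u n)) as [x [Hx1 Hx2]].
  - exists (v 0%nat). intros y [n ->]. apply Cross.
  - exists (u 0%nat). exists 0%nat. reflexivity.
  - exists x. intros n. split.
    + apply Hx1. exists n. reflexivity.
    + apply Hx2. intros y [m ->]. apply Cross.
Qed.

(** Dependent choice, for the sequence of nested rectangles. *)
Lemma dependent_sequence {T : Type} (P : nat -> T -> Prop) (R : nat -> T -> T -> Prop) (t0 : T) :
  P 0%nat t0 ->
  (forall n t, P n t -> exists t', P (S n) t' /\ R n t t') ->
  exists s : nat -> T, s 0%nat = t0 /\ forall n, P n (s n) /\ R n (s n) (s (S n)).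
Proof.
  intros H0 Hstep.
  set (next := fun n (t : {t | P n t}) =>
    constructive_indefinite_description _ (Hstep n (proj1_sig t) (proj2_sig t))).
  set (F := fix F n : {t | P n t} :=
    match n with
    | O => exist _ t0 H0
    | S m => exist _ (proj1_sig (next m (F m))) (proj1 (proj2_sig (next m (F m))))
    end).
  exists (fun n => proj1_sig (F n)). split; [ reflexivity | ].
  intros n. split; [ apply (proj2_sig (F n)) | ].
  exact (proj2 (proj2_sig (next n (F n)))).
Qed.

(** Bisection works from pointwise differentiability, which is all that is known
    of the Schwarz functions of a subordination. If the integral were nonzero, one of the four quarters would
    keep at least a quarter of it, and so on; at the common point of the nested
    rectangles, differentiability makes the integral too small compared with the
    square of the size. *)
Lemma goursat_rectangle (k : C -> C) (a b c d : R) :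
  a <= b -> c <= d ->
  (forall x y, a <= x <= b -> c <= y <= d -> exists l, is_Cderive k ((x, y) : C) l) ->
  boundary k a b c d = 0%C.
Proof.
  intros Hab Hcd Hk.
  assert (Ck : continuous_on_rect k a b c d).
  { intros x y Hx Hy. destruct (Hk x y Hx Hy) as [l Hl].
    apply (is_Cderive_continuous k _ l Hl). }
  destruct (Ceq_dec (boundary k a b c d) 0%C) as [E|E]; [ exact E | exfalso ].
  apply Cmod_gt_0 in E.
  set (w := b - a). set (h := d - c).
  assert (Hw : 0 <= w) by (unfold w; lra). assert (Hh : 0 <= h) by (unfold h; lra).
  (* The [+ 1] makes the initial inequality strict and covers [w + h = 0]. *)
  set (e := Cmod (boundary k a b c d) / ((w + h) ^ 2 + 1)).
  assert (Hl2 := pow2_ge_0 (w + h)).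
  assert (He : 0 < e) by (apply Rdiv_lt_0_compat; lra).
  set (q := fun n : nat => (/ 2) ^ n).
  assert (Hq : forall n, 0 < q n) by (intros n; apply pow_lt; lra).
  assert (HqS : forall n, q n = 2 * q (S n)) by (intros n; unfold q; simpl; lra).
  set (B := fun n (p : R * R) =>
    boundary k (fst p) (fst p + w * q n) (snd p) (snd p + h * q n)).
  (* [p] is the lower left corner of a rectangle of generation [n] that lies in
     the original one and whose boundary integral is too large. *)
  set (P := fun n (p : R * R) =>
    (a <= fst p /\ fst p + w * q n <= b /\ c <= snd p /\ snd p + h * q n <= d) /\
    e * ((w + h) * q n) ^ 2 < Cmod (B n p)).
  set (Rel := fun n (p p' : R * R) =>
    fst p <= fst p' /\ fst p' + w * q (S n) <= fst p + w * q n /\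
    snd p <= snd p' /\ snd p' + h * q (S n) <= snd p + h * q n).
  assert (P0 : P 0%nat (a, c)).
  { split; [ unfold q, w, h; simpl; lra | ].
    unfold B, q; simpl fst; simpl snd; simpl pow at 2 3 4.
    replace (a + w * 1) with b by (unfold w; ring).
    replace (c + h * 1) with d by (unfold h; ring).
    unfold e. apply Rmult_lt_reg_r with ((w + h) ^ 2 + 1); [ lra | ].
    replace (Cmod (boundary k a b c d) / ((w + h) ^ 2 + 1) * ((w + h) * 1) ^ 2 * ((w + h) ^ 2 + 1))
      with (Cmod (boundary k a b c d) * (w + h) ^ 2) by (field; lra).
    apply Rmult_lt_compat_l; lra. }
  assert (Step : forall n p, P n p -> exists p', P (S n) p' /\ Rel n p p').
  { intros n [x y] [(I1 & I2 & I3 & I4) Hbad]; simpl in I1, I2, I3, I4.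
    assert (W : 0 <= w * q (S n)) by (apply Rmult_le_pos; [ lra | apply Rlt_le, Hq ]).
    assert (H : 0 <= h * q (S n)) by (apply Rmult_le_pos; [ lra | apply Rlt_le, Hq ]).
    assert (Ew : w * q n = w * q (S n) + w * q (S n)) by (rewrite HqS; ring).
    assert (Eh : h * q n = h * q (S n) + h * q (S n)) by (rewrite HqS; ring).
    set (x' := x + w * q (S n)). set (y' := y + h * q (S n)).
    assert (Ex : x + w * q n = x' + w * q (S n)) by (unfold x'; lra).
    assert (Ey : y + h * q n = y' + h * q (S n)) by (unfold y'; lra).
    assert (Sp : B n (x, y)
                 = (B (S n) (x, y) + B (S n) (x', y) + B (S n) (x, y') + B (S n) (x', y'))%C).
    { unfold B; simpl fst; simpl snd. rewrite Ex, Ey.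
      apply (boundary_split k); try (unfold x', y'; lra).
      apply (continuous_on_rect_sub k a b c d); unfold x', y'; lra || auto. }
    set (t := e * ((w + h) * q (S n)) ^ 2).
    assert (Et : e * ((w + h) * q n) ^ 2 = 4 * t) by (unfold t; rewrite HqS; ring).
    assert (Hsome : exists p', (p' = (x, y) \/ p' = (x', y) \/ p' = (x, y') \/ p' = (x', y'))
                       /\ t < Cmod (B (S n) p')).
    { destruct (Rlt_dec t (Cmod (B (S n) (x, y)))); [ eauto | ].
      destruct (Rlt_dec t (Cmod (B (S n) (x', y)))); [ eauto | ].
      destruct (Rlt_dec t (Cmod (B (S n) (x, y')))); [ eauto 6 | ].
      destruct (Rlt_dec t (Cmod (B (S n) (x', y')))); [ eauto 7 | exfalso ].
      rewrite Sp, Et in Hbad.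
      assert (T1 := Cmod_triangle (B (S n) (x, y) + B (S n) (x', y) + B (S n) (x, y')) (B (S n) (x', y'))).
      assert (T2 := Cmod_triangle (B (S n) (x, y) + B (S n) (x', y)) (B (S n) (x, y'))).
      assert (T3 := Cmod_triangle (B (S n) (x, y)) (B (S n) (x', y))).
      lra. }
    destruct Hsome as (p' & Hp' & Hlt). exists p'.
    unfold P, Rel. fold t.
    destruct Hp' as [-> | [-> | [-> | ->]]]; simpl fst; simpl snd;
      unfold x', y' in *; (split; [ split; [ lra | exact Hlt ] | lra ]). }
  destruct (dependent_sequence P Rel (a, c) P0 Step) as (s & _ & Hs).
  destruct (nested_point (fun n => fst (s n)) (fun n => fst (s n) + w * q n)) as [x Hx].
  { intros n. apply (proj2 (Hs n)). }
  { intros n. apply (proj2 (Hs n)). }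
  { intros n. assert (0 <= w * q n) by (apply Rmult_le_pos; [ lra | apply Rlt_le, Hq ]). lra. }
  destruct (nested_point (fun n => snd (s n)) (fun n => snd (s n) + h * q n)) as [y Hy].
  { intros n. apply (proj2 (Hs n)). }
  { intros n. apply (proj2 (Hs n)). }
  { intros n. assert (0 <= h * q n) by (apply Rmult_le_pos; [ lra | apply Rlt_le, Hq ]). lra. }
  destruct (Hk x y) as [l Hl].
  { destruct (proj1 (proj1 (Hs 0%nat))). specialize (Hx 0%nat). simpl in Hx. lra. }
  { destruct (proj1 (proj1 (Hs 0%nat))). specialize (Hy 0%nat). simpl in Hy. lra. }
  assert (He2 : 0 < e / 2) by lra.
  destruct (proj1 (is_Cderive_eps _ _ _) Hl (mkposreal _ He2)) as [del Hdel]. simpl in Hdel.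
  destruct (pow_lt_1_zero (/ 2)) with (y := del / (w + h + 1)) as [N HN].
  { rewrite Rabs_pos_eq; lra. }
  { apply Rdiv_lt_0_compat; [ apply cond_pos | lra ]. }
  specialize (HN N (le_n N)). fold (q N) in HN.
  rewrite Rabs_pos_eq in HN by (apply Rlt_le, Hq).
  destruct (Hs N) as [[(I1 & I2 & I3 & I4) Hbad] _].
  specialize (Hx N). specialize (Hy N). simpl in Hx, Hy.
  assert (HqN := Hq N).
  assert (Hsmall : (w + h) * q N < del).
  { apply Rlt_div_r in HN; [ | lra ].
    apply Rle_lt_trans with (2 := HN). lra. }
  assert (HB : Cmod (B N (s N)) <= 2 * ((w + h) * q N) * (e / 2 * ((w + h) * q N))).
  { unfold B. set (p1 := fst (s N)) in *. set (p2 := snd (s N)) in *.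
    replace (2 * ((w + h) * q N)) with (2 * (p1 + w * q N - p1 + (p2 + h * q N - p2))) by ring.
    apply (boundary_near_affine k ((x, y) : C) l).
    - lra.
    - lra.
    - apply (continuous_on_rect_sub k a b c d); auto.
    - intros u v Hu Hv.
      assert (Hz : Cmod ((u, v) - (x, y))%C <= (w + h) * q N).
      { apply Rle_trans with (1 := Cmod_le_abs _ _). simpl.
        assert (Rabs (u + - x) <= w * q N) by (apply Rabs_le; lra).
        assert (Rabs (v + - y) <= h * q N) by (apply Rabs_le; lra).
        lra. }
      apply Rle_trans with (1 := Hdel (u, v) (Rle_lt_trans _ _ _ Hz Hsmall)).
      apply Rmult_le_compat_l; lra. }
  apply (Rlt_irrefl (Cmod (B N (s N)))).
  apply Rle_lt_trans with (1 := HB).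
  replace (2 * ((w + h) * q N) * (e / 2 * ((w + h) * q N)))
    with (e * ((w + h) * q N) ^ 2) by field.
  exact Hbad.
Qed.

(** * Integrals over circles and the bounds of Caratheodory and Schwarz *)

Lemma is_CInt_scal (g : R -> C) (a b : R) (c l : C) :
  is_CInt g a b l -> is_CInt (fun t => (c * g t)%C) a b (c * l)%C.
Proof.
  intros H.
  assert (H1 := is_RInt_fct_extend_fst _ _ _ _ H).
  assert (H2 := is_RInt_fct_extend_snd _ _ _ _ H).
  apply is_RInt_fct_extend_pair.
  - exact (is_RInt_minus _ _ _ _ _ _ (is_RInt_scal _ _ _ (fst c) _ H1)
             (is_RInt_scal _ _ _ (snd c) _ H2)).
  - exact (is_RInt_plus _ _ _ _ _ _ (is_RInt_scal _ _ _ (fst c) _ H2)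
             (is_RInt_scal _ _ _ (snd c) _ H1)).
Qed.

Lemma is_CInt_unique (g : R -> C) (a b : R) (l l' : C) :
  is_CInt g a b l -> is_CInt g a b l' -> l = l'.
Proof.
  intros H H'. rewrite <- (is_RInt_unique (V := C_R_CompleteNormedModule) _ _ _ _ H).
  exact (is_RInt_unique (V := C_R_CompleteNormedModule) _ _ _ _ H').
Qed.

(** The mean over the circle of radius [exp s], up to the factor [2 PI]; the
    logarithmic radius makes circles images of vertical segments. *)
Definition circle_int (h : C -> C) (s : R) (l : C) : Prop :=
  is_CInt (fun t => h (cexp (s, t))) 0 (2 * PI) l.

Lemma circle_int_plus h h' s l l' :
  circle_int h s l -> circle_int h' s l' ->
  circle_int (fun z => (h z + h' z)%C) s (l + l')%C.
Proof. exact (is_RInt_plus (V := C_R_NormedModule) _ _ _ _ l l'). Qed.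

Lemma circle_int_scal c h s l :
  circle_int h s l -> circle_int (fun z => (c * h z)%C) s (c * l)%C.
Proof. apply is_CInt_scal. Qed.

Lemma circle_int_ext h h' s l :
  (forall z, Cmod z = exp s -> h z = h' z) -> circle_int h s l -> circle_int h' s l.
Proof.
  intros E. apply is_RInt_ext. intros t _. apply E. apply Cmod_cexp.
Qed.

Lemma circle_int_Re_ge_0 h s l :
  (forall z, Cmod z = exp s -> 0 <= Re (h z)) -> circle_int h s l -> 0 <= Re l.
Proof.
  intros Hh I. apply is_RInt_fct_extend_fst in I.
  assert (HPI := PI_RGT_0).
  assert (Z := is_RInt_const (V := R_NormedModule) 0 (2 * PI) 0).
  replace (scal (2 * PI - 0) (0 : R_NormedModule)) with 0 in Z
    by (symmetry; apply Rmult_0_r).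
  apply (is_RInt_le _ _ 0 (2 * PI) 0 (Re l) ltac:(lra) Z I).
  intros t _. apply Hh, Cmod_cexp.
Qed.

Lemma circle_punctured_disk (s : R) (z : C) :
  s < 0 -> Cmod z = exp s -> disk z /\ z <> 0%C.
Proof.
  intros Hs Hz. split.
  - unfold disk. rewrite Hz, <- exp_0. apply exp_increasing, Hs.
  - apply Cmod_gt_0. rewrite Hz. apply exp_pos.
Qed.

Definition analytic_punctured (h : C -> C) : Prop :=
  forall z, disk z -> z <> 0%C -> exists l, is_Cderive h z l.

(** In the coordinate [log z] an annulus is a rectangle of height [2 PI]. Its
    horizontal sides carry the same integral by periodicity, so Goursat's
    theorem equates the integrals over the vertical sides, that is, over the two
    circles. *)
Lemma circle_int_indep (h : C -> C) :
  analytic_punctured h -> exists l, forall s, s < 0 -> circle_int h s l.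
Proof.
  intros Hh. set (k := fun z => h (cexp z)).
  assert (Hk : forall x y : R, x < 0 -> exists l, is_Cderive k ((x, y) : C) l).
  { intros x y Hx.
    destruct (circle_punctured_disk x (cexp (x, y)) Hx (Cmod_cexp _)) as [D N].
    destruct (Hh _ D N) as [l Hl]. exists (cexp (x, y) * l)%C.
    apply (is_Cderive_comp h cexp); [ exact Hl | apply is_Cderive_cexp ]. }
  assert (HPI := PI_RGT_0).
  assert (Hc : forall s1 s2, s1 <= s2 -> s2 < 0 ->
    CInt (fun t => k (s2, t)) 0 (2 * PI) = CInt (fun t => k (s1, t)) 0 (2 * PI)).
  { intros s1 s2 H12 H2.
    assert (G := goursat_rectangle k s1 s2 0 (2 * PI) H12 ltac:(lra)
      (fun x y Hx _ => Hk x y ltac:(lra))).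
    unfold boundary in G.
    replace (CInt (fun x => k (x, 2 * PI)) s1 s2) with (CInt (fun x => k (x, 0)) s1 s2) in G.
    - set (u := CInt (fun t => k (s2, t)) 0 (2 * PI)) in *.
      set (v := CInt (fun t => k (s1, t)) 0 (2 * PI)) in *.
      set (c := CInt (fun x => k (x, 0)) s1 s2) in *.
      assert (E : (Ci * u = Ci * v)%C).
      { apply (Cplus_cancel_l (c - c - Ci * v)%C).
        replace (c - c - Ci * v + Ci * u)%C with (c + Ci * u - c - Ci * v)%C by ring.
        rewrite G. ring. }
      apply (Cmult_cancel_l Ci); [ | exact E ].
      intros E0. apply (f_equal snd) in E0. simpl in E0. lra.
    - apply (RInt_ext (V := C_R_CompleteNormedModule)). intros x _. unfold k, cexp; simpl.
      rewrite cos_2PI, sin_2PI, cos_0, sin_0. reflexivity. }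
  exists (CInt (fun t => k (-1, t)) 0 (2 * PI)). intros s Hs.
  replace (CInt (fun t => k (-1, t)) 0 (2 * PI)) with (CInt (fun t => k (s, t)) 0 (2 * PI)).
  - apply (RInt_correct (V := C_R_CompleteNormedModule)).
    apply (ex_CInt_vertical k s s 0 (2 * PI)); try lra.
    intros x y Hx _. destruct (Hk x y ltac:(lra)) as [l Hl].
    apply (is_Cderive_continuous _ _ _ Hl).
  - destruct (Rle_dec s (-1)).
    + symmetry. apply Hc; lra.
    + apply Hc; lra.
Qed.

(** The mean value property, with a removable singularity at the centre: let
    the radius tend to 0 in the constant of [circle_int_indep]. *)
Lemma circle_int_center (h q : C -> C) :
  analytic_punctured h -> continuous q (RtoC 0) ->
  (exists d : posreal, forall z, Cmod z < d -> z <> 0%C -> h z = q z) ->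
  forall s, s < 0 -> circle_int h s (2 * PI * q 0)%C.
Proof.
  intros Hh Cq [d Hd].
  destruct (circle_int_indep h Hh) as [l Hl].
  assert (HPI := PI_RGT_0).
  replace (2 * PI * q 0)%C with l; [ exact Hl | ].
  destruct (Ceq_dec l (2 * PI * q 0)%C) as [E|E]; [ exact E | exfalso ].
  set (L := q (RtoC 0)) in *.
  assert (Hp : 0 < Cmod (l - 2 * PI * L)%C) by (apply Cmod_gt_0, Cminus_eq_contra, E).
  set (e := Cmod (l - 2 * PI * L)%C / (4 * PI)).
  assert (He : 0 < e) by (apply Rdiv_lt_0_compat; lra).
  destruct (proj1 (continuous_Cmod _ _) Cq (mkposreal _ He)) as [d' Hd']. simpl in Hd'.
  assert (Hm : 0 < Rmin d d') by (apply Rmin_glb_lt; apply cond_pos).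
  set (s := Rmin (-1) (ln (Rmin d d') - 1)).
  assert (Hs : s < 0) by (apply Rle_lt_trans with (-1); [ apply Rmin_l | lra ]).
  assert (Hes : exp s < Rmin d d').
  { rewrite <- (exp_ln (Rmin d d')) by exact Hm. apply exp_increasing.
    apply Rle_lt_trans with (1 := Rmin_r _ _). lra. }
  assert (B : Cmod (l - 2 * PI * L)%C <= (2 * PI - 0) * e).
  { rewrite Cmod_norm.
    apply (norm_RInt_le_const (V := C_R_NormedModule)
             (fun t => (h (cexp (s, t)) - (L + t * 0))%C)).
    - lra.
    - intros t _. rewrite <- Cmod_norm.
      assert (Hz := Cmod_cexp (s, t)). simpl in Hz.
      destruct (circle_punctured_disk s _ Hs Hz) as [_ N].
      rewrite Hd; [ | rewrite Hz; apply Rlt_le_trans with (1 := Hes), Rmin_l | exact N ].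
      replace (L + t * 0)%C with L by ring.
      apply Rlt_le, Hd'.
      replace (cexp (s, t) - 0)%C with (cexp (s, t)) by ring.
      rewrite Hz. apply Rlt_le_trans with (1 := Hes), Rmin_r.
    - replace (l - 2 * PI * L)%C
        with (l - (((2 * PI)%R - 0) * L + ((2 * PI)%R ^ 2 - 0 ^ 2) / 2 * 0))%C
        by (rewrite RtoC_mult; ring).
      apply (is_RInt_minus (V := C_R_NormedModule)); [ exact (Hl s Hs) | ].
      apply is_CInt_affine. }
  assert (Ee : (2 * PI - 0) * e = Cmod (l - 2 * PI * L)%C / 2) by (unfold e; field; lra).
  lra.
Qed.

Lemma is_Cderive_pow (n : nat) (z : C) : exists l, is_Cderive (fun y => (y ^ n)%C) z l.
Proof.
  induction n as [|n [l IH]]; simpl.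
  - exists 0%C. apply is_Cderive_const.
  - eexists. apply (is_Cderive_mult (fun y => y)); [ apply is_Cderive_id | exact IH ].
Qed.

Lemma analytic_punctured_div_pow (p : C -> C) (n : nat) :
  analytic_punctured p -> analytic_punctured (fun z => (p z / z ^ n)%C).
Proof.
  intros Hp z Hz Hz0. destruct (Hp z Hz Hz0) as [l Hl].
  destruct (is_Cderive_pow n z) as [l' Hl'].
  eexists. apply (is_Cderive_mult p (fun y => / y ^ n)%C).
  - exact Hl.
  - apply (is_Cderive_inv (fun y => (y ^ n)%C)); [ exact Hl' | apply Cpow_nz, Hz0 ].
Qed.

(** Halving the radius multiplies the integrand by [2^(n+1)] and does not change
    the integral, which is therefore 0. *)
Lemma circle_int_inv_pow (n : nat) (s : R) :
  s < 0 -> circle_int (fun z => (1 / z ^ S n)%C) s 0%C.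
Proof.
  intros Hs.
  destruct (circle_int_indep (fun z => (1 / z ^ S n)%C)) as [l Hl].
  { apply (analytic_punctured_div_pow (fun _ => RtoC 1)).
    intros z _ _. exists (RtoC 0). apply is_Cderive_const. }
  replace (RtoC 0) with l; [ exact (Hl s Hs) | ].
  assert (Hln : 0 < ln 2) by (rewrite <- ln_1; apply ln_increasing; lra).
  assert (E : l = (RtoC (2 ^ S n) * l)%C).
  { apply (is_CInt_unique (fun t => (1 / cexp (s - ln 2, t)%R ^ S n)%C) 0 (2 * PI)).
    - apply Hl. lra.
    - apply is_RInt_ext with (2 := is_CInt_scal _ _ _ (RtoC (2 ^ S n)) _ (Hl s Hs)).
      intros t _.
      assert (Ec : cexp (s - ln 2, t) = (cexp (s, t) * / 2)%C).
      { unfold cexp; simpl. unfold Rminus. rewrite exp_plus, exp_Ropp, exp_ln by lra.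
        apply injective_projections; simpl; field. }
      assert (N : cexp (s, t) <> 0%C).
      { apply Cmod_gt_0. rewrite Cmod_cexp. apply exp_pos. }
      assert (N2 : RtoC 2 <> 0%C) by (intros E2; apply RtoC_inj in E2; lra).
      rewrite Ec, Cpow_mult_l, Cpow_inv, RtoC_pow by exact N2.
      assert (N3 := Cpow_nz (cexp (s, t)) (S n) N). assert (N4 := Cpow_nz (RtoC 2) (S n) N2).
      match goal with |- @eq _ ?x ?y => change (@eq C x y) end. field. auto. }
  assert (E2 : (RtoC (2 ^ S n - 1) * l = RtoC (2 ^ S n - 1) * 0)%C).
  { rewrite RtoC_minus. transitivity (RtoC (2 ^ S n) * l - l)%C; [ ring | ].
    rewrite <- E. ring. }
  apply Cmult_cancel_l in E2; [ exact E2 | ].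
  intros E3. apply RtoC_inj in E3.
  assert (1 < 2 ^ S n) by (apply Rlt_pow_R1; [ lra | lia ]). lra.
Qed.

(** On the unit circle [/ w] is the conjugate of [w], so the kernel is the
    nonnegative real number [2 + 2 Re w]. *)
Lemma Re_mult_unit_kernel (w p : C) :
  Cmod w = 1 -> 0 <= Re p -> 0 <= Re ((2 + w + / w) * p)%C.
Proof.
  intros Hw Hp.
  assert (Nw : w <> 0%C) by (apply Cmod_gt_0; lra).
  assert (E : (/ w = Cconj w)%C).
  { apply (Cmult_cancel_l w); [ exact Nw | ]. rewrite <- Cmod2_conj, Hw, Cinv_r by exact Nw.
    unfold RtoC. f_equal. ring. }
  rewrite E. assert (B := re_le_Cmod w). rewrite Hw in B.
  apply Rabs_le_between in B. destruct w as [x y], p as [u v]. simpl in *.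
  replace ((2 + x + x) * u - (0 + y + - y) * v) with (2 * (1 + x) * u) by ring.
  apply Rmult_le_pos; lra.
Qed.

Section Caratheodory.
Variable p : C -> C.
Hypothesis p_analytic : analytic p.
Hypothesis p_pos : forall z, disk z -> 0 <= Re (p z).

(** Let [c] be the coefficient of [z^(n+1)] in [p]. Integrating [p] against the
    nonnegative kernel [2 + w + / w], where [w = g (r / z)^(n+1)] on the circle
    of radius [r] and [|g| = 1], gives [Re (2 + g c r^(n+1)) >= 0] up to a
    positive factor. The choice [g c = - |c|] and [r -> 1] yield [|c| <= 2]. *)
Lemma caratheodory_of_circle_int (n : nat) (c : C) :
  p 0%C = 1%C ->
  (forall s, s < 0 -> circle_int (fun z => (p z / z ^ S n)%C) s (2 * PI * c)%C) ->
  Cmod c <= 2.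
Proof.
  intros p0 Hc. assert (HPI := PI_RGT_0).
  assert (p_punct : analytic_punctured p) by (intros z Hz _; exact (p_analytic z Hz)).
  assert (Cp : continuous p (RtoC 0)).
  { destruct (p_analytic 0%C disk_0) as [l Hl]. apply (is_Cderive_continuous _ _ _ Hl). }
  assert (M0 : forall s, s < 0 -> circle_int p s (2 * PI * 1)%C).
  { rewrite <- p0. apply circle_int_center; auto.
    exists (mkposreal 1 Rlt_0_1). reflexivity. }
  assert (Mn : forall s, s < 0 -> circle_int (fun z => (p z * z ^ S n)%C) s 0%C).
  { replace (RtoC 0) with (2 * PI * (p 0 * 0 ^ S n))%C by (simpl; ring).
    apply (circle_int_center _ (fun z => (p z * z ^ S n)%C)).
    - intros z Hz Hz0. destruct (p_punct z Hz Hz0) as [l Hl].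
      destruct (is_Cderive_pow (S n) z) as [l' Hl'].
      eexists. apply is_Cderive_mult; [ exact Hl | exact Hl' ].
    - cont.
    - exists (mkposreal 1 Rlt_0_1). reflexivity. }
  destruct (Ceq_dec c 0%C) as [->|Nc]; [ rewrite Cmod_0; lra | ].
  set (m := Cmod c). assert (Hm : 0 < m) by (apply Cmod_gt_0; auto).
  assert (Nm : RtoC m <> 0%C) by (intros E; apply RtoC_inj in E; lra).
  set (g := (- Cconj c / m)%C).
  assert (Hg : Cmod g = 1).
  { unfold g. rewrite Cmod_div, Cmod_opp, Cmod_conj, Cmod_R, Rabs_pos_eq by (auto; lra).
    fold m. field. lra. }
  assert (Hgc : (g * c = - m)%C).
  { unfold g. replace (- Cconj c / m * c)%C with (- (c * Cconj c) / m)%C by (field; auto).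
    rewrite <- Cmod2_conj. fold m. rewrite RtoC_pow. field. auto. }
  assert (Ng : g <> 0%C) by (apply Cmod_gt_0; lra).
  assert (Key : forall s, s < 0 -> exp s ^ S n * m <= 2).
  { intros s Hs. set (r := exp s ^ S n).
    assert (Hr : 0 < r) by (apply pow_lt, exp_pos).
    assert (Nr : RtoC r <> 0%C) by (intros E; apply RtoC_inj in E; lra).
    assert (I : circle_int (fun z => ((2 + g * r / z ^ S n + / (g * r / z ^ S n)) * p z)%C) s
                  (2 * (2 * PI * 1) + g * r * (2 * PI * c) + / (g * r) * 0)%C).
    { apply circle_int_ext with (h := fun z =>
        (2 * p z + (g * r) * (p z / z ^ S n) + / (g * r) * (p z * z ^ S n))%C).
      - intros z Hz. destruct (circle_punctured_disk s z Hs Hz) as [_ N].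
        assert (N' := Cpow_nz z (S n) N). field. auto.
      - apply (circle_int_plus (fun z => (2 * p z + (g * r) * (p z / z ^ S n))%C)).
        + apply (circle_int_plus (fun z => (2 * p z)%C)); apply circle_int_scal; auto.
        + apply circle_int_scal. auto. }
    replace (2 * (2 * PI * 1) + g * r * (2 * PI * c) + / (g * r) * 0)%C
      with (RtoC (4 * PI - 2 * PI * (r * m))) in I.
    - assert (P : 0 <= 4 * PI - 2 * PI * (r * m)).
      { apply (circle_int_Re_ge_0 _ _ _) with (2 := I). intros z Hz.
        destruct (circle_punctured_disk s z Hs Hz) as [D N].
        apply Re_mult_unit_kernel; [ | auto ].
        rewrite Cmod_div by (apply Cpow_nz, N).
        rewrite Cmod_mult, Cmod_pow, Hz, Hg, Cmod_R, Rabs_pos_eq by lra.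
        fold r. field. lra. }
      nra.
    - replace (g * r * (2 * PI * c))%C with (2 * PI * r * (g * c))%C by ring.
      rewrite Hgc, RtoC_minus, !RtoC_mult. field. auto. }
  destruct (Rle_dec m 2) as [Hle|Hgt]; [ exact Hle | exfalso ].
  assert (HN : 0 < INR (S n)) by (apply lt_0_INR; lia).
  (* A radius so close to 1 that [exp ((n+1) s) >= 1 + (n+1) s] already
     contradicts [Key]. *)
  set (s := - ((m - 2) / (2 * INR (S n) * m))).
  assert (HD : 0 < (m - 2) / (2 * INR (S n) * m)).
  { apply Rdiv_lt_0_compat; [ lra | ]. repeat apply Rmult_lt_0_compat; lra. }
  assert (Hs : s < 0) by (unfold s; lra).
  specialize (Key s Hs).
  assert (Hpow : exp s ^ S n = exp (INR (S n) * s)).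
  { generalize (S n). intros k. induction k as [|k IH].
    - simpl. rewrite Rmult_0_l, exp_0. reflexivity.
    - rewrite S_INR, Rmult_plus_distr_r, Rmult_1_l, exp_plus, <- IH. simpl. ring. }
  assert (B := exp_ineq1_le (INR (S n) * s)). rewrite <- Hpow in B.
  assert (E : (1 + INR (S n) * s) * m = (m + 2) / 2) by (unfold s; field; lra).
  assert ((1 + INR (S n) * s) * m <= exp s ^ S n * m) by (apply Rmult_le_compat_r; lra).
  lra.
Qed.

(** The first two coefficients of a function with positive real part and value 1
    at the origin are at most 2: subtracting the singular part of
    [p z / z^k] leaves a function with a removable singularity. *)
Lemma caratheodory_jet2 (c1 c2 : C) :
  jet2 p 1 c1 c2 -> Cmod c1 <= 2 /\ Cmod c2 <= 2.
Proof.
  intros J. assert (p0 := jet2_0 _ _ _ _ J).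
  destruct J as (h & Ch & H2 & H). apply locally_Cmod in H. destruct H as [d Hd].
  assert (An : forall b b' k, analytic_punctured (fun z => ((p z - b - b' * z) / z ^ k)%C)).
  { intros b b' k. apply (analytic_punctured_div_pow (fun z => (p z - b - b' * z)%C)).
    intros z Hz _. destruct (p_analytic z Hz) as [l Hl]. eexists.
    apply (is_Cderive_minus (fun z => (p z - b)%C)).
    - apply is_Cderive_minus; [ exact Hl | apply is_Cderive_const ].
    - apply is_Cderive_mult; [ apply is_Cderive_const | apply is_Cderive_id ]. }
  split.
  - apply (caratheodory_of_circle_int 0); [ exact p0 | ]. intros s Hs.
    apply circle_int_ext with (h := fun z => ((p z - 1 - 0 * z) / z ^ 1 + 1 / z ^ 1)%C).
    + intros z Hz. destruct (circle_punctured_disk s z Hs Hz) as [_ N]. simpl. field. exact N.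
    + replace (2 * PI * c1)%C with (2 * PI * (c1 + 0 * h 0) + 0)%C by ring.
      apply circle_int_plus; [ | apply circle_int_inv_pow, Hs ].
      apply (circle_int_center _ (fun z => (c1 + z * h z)%C)); [ apply An | cont | | exact Hs ].
      exists d. intros z Hz Nz. rewrite Hd by (replace (z - 0)%C with z by ring; exact Hz).
      simpl. field. exact Nz.
  - apply (caratheodory_of_circle_int 1); [ exact p0 | ]. intros s Hs.
    apply circle_int_ext with (h := fun z =>
      ((p z - 1 - c1 * z) / z ^ 2 + (1 / z ^ 2 + c1 * (1 / z ^ 1)))%C).
    + intros z Hz. destruct (circle_punctured_disk s z Hs Hz) as [_ N]. simpl. field. exact N.
    + replace (2 * PI * c2)%C with (2 * PI * h 0 + (0 + c1 * 0))%C by (rewrite H2; ring).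
      apply circle_int_plus.
      * apply (circle_int_center _ h); [ apply An | exact Ch | | exact Hs ].
        exists d. intros z Hz Nz. rewrite Hd by (replace (z - 0)%C with z by ring; exact Hz).
        simpl. field. exact Nz.
      * apply circle_int_plus; [ apply circle_int_inv_pow, Hs | ].
        apply circle_int_scal, circle_int_inv_pow, Hs.
Qed.
End Caratheodory.

Lemma Re_cayley (w : C) : Cmod w < 1 -> 0 <= Re ((1 + w) * / (1 - w))%C.
Proof.
  intros Hw. assert (H2 := Cmod2_alt w).
  assert (H1 : Cmod w ^ 2 < 1).
  { assert (T := Cmod_ge_0 w). nra. }
  destruct w as [x y]. simpl Re in *. simpl Im in *.
  assert (D : 0 < (1 - x) ^ 2 + y ^ 2).
  { destruct (Req_dec x 1) as [->|Nx].
    - assert (0 <= y ^ 2) by apply pow2_ge_0. nra.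
    - assert (0 < (1 - x) ^ 2) by (apply pow2_gt_0; lra).
      assert (0 <= y ^ 2) by apply pow2_ge_0. lra. }
  apply Rle_trans with ((1 - (x ^ 2 + y ^ 2)) / ((1 - x) ^ 2 + y ^ 2)).
  - apply Rlt_le, Rdiv_lt_0_compat; lra.
  - right. simpl. field. intros E. nra.
Qed.

(** The Cayley transform [p = (1 + u) / (1 - u)] has positive real part and
    expansion [1 + 2 u1 z + 2 (u2 + u1^2) z^2], to which [caratheodory_jet2]
    applies. *)
Lemma schwarz_jet2 (u : C -> C) (u1 u2 : C) :
  analytic u -> (forall z, disk z -> disk (u z)) -> jet2 u 0 u1 u2 ->
  Cmod u1 <= 1 /\ Cmod (u2 + u1 * u1)%C <= 1.
Proof.
  intros Au Du J.
  set (p := fun z => ((1 + u z) * / (1 + - 1 * u z))%C).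
  assert (Np : forall z, disk z -> (1 + - 1 * u z)%C <> 0%C).
  { intros z Hz E. specialize (Du z Hz). unfold disk in Du.
    replace (u z) with (RtoC 1) in Du.
    - rewrite Cmod_1 in Du. lra.
    - replace (u z) with (1 - (1 + - 1 * u z))%C by ring. rewrite E. ring. }
  assert (Ap : analytic p).
  { intros z Hz. destruct (Au z Hz) as [l Hl]. eexists.
    apply is_Cderive_mult.
    - apply (is_Cderive_plus (fun _ => RtoC 1)); [ apply is_Cderive_const | exact Hl ].
    - apply is_Cderive_inv; [ | apply Np, Hz ].
      apply (is_Cderive_plus (fun _ => RtoC 1)); [ apply is_Cderive_const | ].
      apply (is_Cderive_mult (fun _ => (- 1)%C)); [ apply is_Cderive_const | exact Hl ]. }
  assert (Pp : forall z, disk z -> 0 <= Re (p z)).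
  { intros z Hz. unfold p. replace (1 + - 1 * u z)%C with (1 - u z)%C by ring.
    apply Re_cayley, Du, Hz. }
  assert (Jp : jet2 p 1 (2 * u1) (2 * (u2 + u1 * u1))).
  { assert (J1 := jet2_plus _ _ _ _ _ _ _ _ (jet2_const 1) J).
    assert (J2 := jet2_mult _ _ _ _ _ _ _ _ (jet2_const (- 1)) J).
    assert (J3 := jet2_plus _ _ _ _ _ _ _ _ (jet2_const 1) J2).
    assert (N0 : (1 + - 1 * 0)%C <> 0%C).
    { replace (1 + - 1 * 0)%C with (RtoC 1) by ring. intros E. apply RtoC_inj in E. lra. }
    assert (J4 := jet2_mult _ _ _ _ _ _ _ _ J1 (jet2_inv _ _ _ _ N0 J3)).
    cbv beta in J4. fold p in J4.
    match type of J4 with jet2 _ ?x ?y ?z =>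
      replace (RtoC 1) with x by (field; auto);
      replace (2 * u1)%C with y by (field; auto);
      replace (2 * (u2 + u1 * u1))%C with z by (field; auto) end.
    exact J4. }
  destruct (caratheodory_jet2 p Ap Pp _ _ Jp) as [H1 H2].
  rewrite Cmod_mult, Cmod_R, Rabs_pos_eq in H1, H2 by lra.
  split; lra.
Qed.

(** * Coefficients of the starlike expression of a series and of its inverse *)

Lemma jet2_eq f c0 c1 c2 c0' c1' c2' :
  jet2 f c0 c1 c2 -> c0 = c0' -> c1 = c1' -> c2 = c2' -> jet2 f c0' c1' c2'.
Proof. intros H -> -> ->. exact H. Qed.

Lemma locally_disk : locally (RtoC 0) disk.
Proof.
  apply locally_Cmod. exists (mkposreal 1 Rlt_0_1). intros y Hy. simpl in Hy.
  replace (y - 0)%C with y in Hy by ring. exact Hy.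
Qed.

Lemma RtoC_neq_0 (x : R) : x <> 0 -> RtoC x <> 0%C.
Proof. intros H E. apply RtoC_inj in E. auto. Qed.

Section NormalizedSeries.
Variables (f : C -> C) (a : nat -> C).
Hypothesis f_taylor : taylor_expansion f a.
Hypothesis a0 : a 0%nat = 0%C.
Hypothesis a1 : a 1%nat = 1%C.

Let r := quotient0 f (a 1%nat).
Let f' := C_derive f.
Let f'' := C_derive f'.

Lemma f_eq_mult_quotient (z : C) : f z = (z * r z)%C.
Proof.
  unfold r. rewrite (quotient0_eq f (a 1%nat) z), (taylor_at_0 f a f_taylor), a0 at 1.
  ring.
Qed.

Lemma f_jet2 : jet2 f 0 1 (a 2%nat).
Proof. rewrite <- a0, <- a1. apply taylor_jet2, f_taylor. Qed.

Lemma r_jet2 : jet2 r 1 (a 2%nat) (a 3%nat).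
Proof. rewrite <- a1. apply (taylor_jet2 r (fun n => a (S n))), taylor_shift, f_taylor. Qed.

Lemma f'_jet2 : jet2 f' 1 (2 * a 2%nat) (3 * a 3%nat).
Proof.
  apply (jet2_eq _ _ _ _ _ _ _ (taylor_jet2 _ _ (taylor_C_derive f a f_taylor)));
    unfold Cderive_coef; rewrite ?a1; simpl INR; rewrite ?RtoC_plus; ring.
Qed.

Lemma z_mult_f''_jet2 : jet2 (fun z => z * f'' z)%C 0 (2 * a 2%nat) (6 * a 3%nat).
Proof.
  assert (J := jet2_mult _ _ _ _ _ _ _ _ jet2_id
    (taylor_jet2 _ _ (taylor_C_derive _ _ (taylor_C_derive f a f_taylor)))).
  apply (jet2_eq _ _ _ _ _ _ _ J);
    unfold Cderive_coef; simpl INR; rewrite ?RtoC_plus; ring.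
Qed.

(** Dividing numerator and denominator of the starlike expression by [z] turns it
    into [(f' + alpha z f'') / r] with [f = z r], which is regular at 0. *)
Lemma st_expr_jet2 (alpha : R) (F : C -> C) :
  F 0%C = 1%C -> removable_ext (st_expr alpha f) F ->
  jet2 F 1 ((1 + 2 * alpha) * a 2%nat)
    ((2 + 6 * alpha) * a 3%nat - (1 + 2 * alpha) * (a 2%nat * a 2%nat)).
Proof.
  intros F0 [_ HF].
  assert (N1 : RtoC 1 <> 0%C) by (apply RtoC_neq_0; lra).
  assert (J := jet2_mult _ _ _ _ _ _ _ _
    (jet2_plus _ _ _ _ _ _ _ _ f'_jet2
      (jet2_mult _ _ _ _ _ _ _ _ (jet2_const alpha) z_mult_f''_jet2))
    (jet2_inv _ _ _ _ N1 r_jet2)).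
  cbv beta in J.
  refine (jet2_eq _ _ _ _ _ _ _ (jet2_ext_loc _ F _ _ _ _ J) _ _ _); try (field; exact N1).
  assert (Cr := jet2_continuous _ _ _ _ r_jet2).
  assert (Nr : r (RtoC 0) <> 0%C) by (rewrite (jet2_0 _ _ _ _ r_jet2); exact N1).
  generalize (filter_and _ _ locally_disk (continuous_Cneq_0 r _ Cr Nr)).
  apply filter_imp. intros z [Dz Nz].
  destruct (Ceq_dec z 0%C) as [->|Nz0].
  - rewrite F0, (jet2_0 _ _ _ _ r_jet2), (jet2_0 _ _ _ _ f'_jet2). field; exact N1.
  - rewrite (HF z Dz Nz0). unfold st_expr. rewrite (f_eq_mult_quotient z).
    fold f'. fold f''. field. auto.
Qed.

Section Inverse.
Variable g : C -> C.
Hypothesis g_inv : univalent_inverse f g.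

Lemma inverse_0 : g 0%C = 0%C.
Proof.
  destruct g_inv as [_ H]. apply locally_singleton in H.
  rewrite (jet2_0 _ _ _ _ f_jet2) in H. exact H.
Qed.

Lemma inverse_continuous_0 : continuous g (RtoC 0).
Proof.
  destruct g_inv as [[Ag _] _]. destruct (Ag 0%C disk_0) as [l Hl].
  apply (is_Cderive_continuous _ _ _ Hl).
Qed.

(** Injectivity of [g] makes the local left inverse also a local right inverse:
    [g (f (g w)) = g w] near the origin. *)
Lemma inverse_right : locally (RtoC 0) (fun w : C => disk (g w) /\ f (g w) = w).
Proof.
  assert (Cg := inverse_continuous_0). assert (Cf := jet2_continuous _ _ _ _ f_jet2).
  assert (Cfg : continuous (fun w => f (g w)) (RtoC 0)).
  { apply continuous_comp; [ exact Cg | rewrite inverse_0; exact Cf ]. }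
  assert (L1 : locally (RtoC 0) (fun w : C => g (f (g w)) = g w)).
  { apply (Cg (fun z : C => g (f z) = z)). rewrite inverse_0. apply g_inv. }
  assert (L2 : locally (RtoC 0) (fun w : C => disk (g w))).
  { apply (Cg disk). rewrite inverse_0. apply locally_disk. }
  assert (L3 : locally (RtoC 0) (fun w : C => disk (f (g w)))).
  { apply (Cfg disk). rewrite inverse_0, (jet2_0 _ _ _ _ f_jet2). apply locally_disk. }
  generalize (filter_and _ _ (filter_and _ _ L1 L2) (filter_and _ _ L3 locally_disk)).
  apply filter_imp. intros w [[E D1] [D2 D3]]. split; [ exact D1 | ].
  destruct g_inv as [[_ Inj] _]. apply Inj; auto.
Qed.

Lemma inverse_jet2 : jet2 g 0 1 (- a 2%nat).
Proof.
  assert (N1 : RtoC 1 <> 0%C) by (apply RtoC_neq_0; lra).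
  destruct (jet2_of_comp f g 0 1 (a 2%nat) 0 1 0) as (g1 & g2 & J & E1 & E2).
  - exact N1.
  - exact f_jet2.
  - exact inverse_0.
  - destruct g_inv as [[Ag _] _]. apply Ag, disk_0.
  - refine (jet2_ext_loc _ _ _ _ _ _ jet2_id).
    generalize inverse_right. apply filter_imp. intros w [_ E]. symmetry. exact E.
  - assert (Eg1 : g1 = 1%C) by (rewrite E1; ring).
    apply (jet2_eq _ _ _ _ _ _ _ J); [ reflexivity | exact Eg1 | ].
    rewrite Eg1 in E2. transitivity (1 * g2 + a 2%nat * (1 * 1) - a 2%nat)%C; [ ring | ].
    rewrite <- E2. ring.
Qed.

Lemma is_Cderive_inverse :
  locally (RtoC 0) (fun w : C => f' (g w) <> 0%C /\ is_Cderive g w (/ f' (g w))%C).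
Proof.
  generalize (filter_and _ _ (locally_locally _ _ inverse_right) locally_disk).
  apply filter_imp. intros w [L D].
  destruct (locally_singleton _ _ L) as [Dg _].
  destruct g_inv as [[Ag _] _]. destruct (Ag w D) as [l Hl].
  assert (H1 := is_Cderive_comp f g w _ _ (taylor_is_C_derive f a (g w) f_taylor Dg) Hl).
  assert (H2 : is_Cderive (fun y : C => y) w (l * f' (g w))%C).
  { apply is_Cderive_ext_loc with (2 := H1).
    revert L. apply filter_imp. intros y [_ E]. exact E. }
  assert (E : (l * f' (g w) = 1)%C).
  { rewrite <- (is_C_derive_unique _ _ _ H2).
    apply is_C_derive_unique, is_Cderive_id. }
  assert (Nf : f' (g w) <> 0%C).
  { intros E0. rewrite E0, Cmult_0_r in E. apply RtoC_inj in E. lra. }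
  split; [ exact Nf | ].
  replace (/ f' (g w))%C with l; [ exact Hl | ].
  apply (Cmult_cancel_l (f' (g w))); [ exact Nf | ].
  rewrite Cinv_r by exact Nf. rewrite <- E. ring.
Qed.

(** Since [g' = 1 / f'(g)] on a whole neighbourhood, [g'] is differentiable there
    although [g] is only assumed complex differentiable. *)
Lemma C_derive_inverse :
  locally (RtoC 0) (fun w : C => C_derive g w = (/ f' (g w))%C /\
    C_derive (C_derive g) w = (- f'' (g w) / (f' (g w) ^ 3))%C).
Proof.
  assert (L := is_Cderive_inverse).
  generalize (filter_and _ _ (filter_and _ _ L inverse_right) (locally_locally _ _ L)).
  apply filter_imp. intros w [[[N D] [Dg _]] LL].
  split; [ apply is_C_derive_unique, D | ].
  apply is_C_derive_unique.
  apply (is_Cderive_ext_loc (fun y => (/ f' (g y))%C)).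
  - revert LL. apply filter_imp. intros y [_ Dy]. symmetry. apply is_C_derive_unique, Dy.
  - assert (H := is_Cderive_inv (fun y => f' (g y)) w _
      (is_Cderive_comp f' g w _ _
         (taylor_is_C_derive f' _ (g w) (taylor_C_derive f a f_taylor) Dg) D) N).
    fold f'' in H. cbv beta in H.
    replace (- f'' (g w) / f' (g w) ^ 3)%C
      with (- (/ f' (g w) * f'' (g w)) / (f' (g w) * f' (g w)))%C; [ exact H | ].
    simpl. field. exact N.
Qed.

(** Substituting [w = f z] in the starlike expression of [g] gives
    [r / f' - alpha z f'' r^2 / f'^3] at [z = g w], so that expansions of [f] and
    the second-order expansion of [g] are enough. *)
Lemma st_expr_inverse_jet2 (alpha : R) (G : C -> C) :
  G 0%C = 1%C -> removable_ext (st_expr alpha g) G ->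
  jet2 G 1 (- (1 + 2 * alpha) * a 2%nat)
    ((3 + 10 * alpha) * (a 2%nat * a 2%nat) - (2 + 6 * alpha) * a 3%nat).
Proof.
  intros G0 [_ HG].
  assert (N1 : RtoC 1 <> 0%C) by (apply RtoC_neq_0; lra).
  assert (Ji := jet2_inv _ _ _ _ N1 f'_jet2).
  assert (Jq := jet2_mult _ _ _ _ _ _ _ _ r_jet2 Ji).
  assert (Jm := jet2_mult _ _ _ _ _ _ _ _ (jet2_mult _ _ _ _ _ _ _ _ Jq Jq) Ji).
  assert (Js := jet2_mult _ _ _ _ _ _ _ _
    (jet2_mult _ _ _ _ _ _ _ _ (jet2_const (- alpha)) z_mult_f''_jet2) Jm).
  assert (J := jet2_comp _ _ _ _ _ _ _ (jet2_plus _ _ _ _ _ _ _ _ Jq Js) inverse_jet2).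
  cbv beta in J. clear Ji Jq Jm Js.
  refine (jet2_eq _ _ _ _ _ _ _ (jet2_ext_loc _ G _ _ _ _ J) _ _ _); try (field; exact N1).
  generalize (filter_and _ _ (filter_and _ _ locally_disk inverse_right)
                (filter_and _ _ is_Cderive_inverse C_derive_inverse)).
  apply filter_imp. intros w [[Dw [_ E]] [[N _] [E1 E2]]].
  destruct (Ceq_dec w 0%C) as [->|Nw].
  - rewrite G0, inverse_0, (jet2_0 _ _ _ _ r_jet2), (jet2_0 _ _ _ _ f'_jet2). field; exact N1.
  - rewrite (HG w Dw Nw). unfold st_expr. rewrite E1, E2.
    rewrite (f_eq_mult_quotient (g w)) in E.
    assert (Ng : g w <> 0%C).
    { intros E0. apply Nw. rewrite <- E, E0. ring. }
    set (z := g w) in *. clearbody z. rewrite <- E.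
    simpl. field. auto.
Qed.
End Inverse.
End NormalizedSeries.

Lemma subordinate_jet2 (phi F : C -> C) (B : nat -> C) (F1 F2 : C) :
  taylor_expansion phi B -> B 1%nat <> 0%C -> subordinate F phi -> jet2 F (B 0%nat) F1 F2 ->
  exists u1 u2, F1 = (B 1%nat * u1)%C /\
    F2 = (B 1%nat * u2 + B 2%nat * (u1 * u1))%C /\
    Cmod u1 <= 1 /\ Cmod (u2 + u1 * u1)%C <= 1.
Proof.
  intros HB N (_ & _ & u & Au & Du & u0 & E) J.
  destruct (jet2_of_comp phi u _ _ _ (B 0%nat) F1 F2 N (taylor_jet2 phi B HB) u0 (Au _ disk_0))
    as (u1 & u2 & Ju & E1 & E2).
  - refine (jet2_ext_loc _ _ _ _ _ _ J). generalize locally_disk. apply filter_imp. exact E.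
  - exists u1, u2. split; [ exact E1 | split; [ exact E2 | ] ].
    apply (schwarz_jet2 u); assumption.
Qed.

Lemma subordinate_0 (F phi : C -> C) : subordinate F phi -> F 0%C = phi 0%C.
Proof.
  intros (_ & _ & u & _ & _ & u0 & E). rewrite (E 0%C disk_0), u0. reflexivity.
Qed.

(** * Bounds from the coefficient relations *)

Section Algebra.
Variables (alpha b : R) (a2 a3 B2 u1 u2 v1 v2 : C).
Hypothesis alpha_ge_0 : 0 <= alpha.
Hypothesis b_pos : 0 < b.
Hypothesis Eu1 : ((1 + 2 * alpha) * a2 = b * u1)%C.
Hypothesis Eu2 : ((2 + 6 * alpha) * a3 - (1 + 2 * alpha) * (a2 * a2) = b * u2 + B2 * (u1 * u1))%C.
Hypothesis Ev1 : (- (1 + 2 * alpha) * a2 = b * v1)%C.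
Hypothesis Ev2 : ((3 + 10 * alpha) * (a2 * a2) - (2 + 6 * alpha) * a3 = b * v2 + B2 * (v1 * v1))%C.
Hypothesis Bu1 : Cmod u1 <= 1.
Hypothesis Bu2 : Cmod (u2 + u1 * u1)%C <= 1.
Hypothesis Bv2 : Cmod (v2 + v1 * v1)%C <= 1.

Let U := (u2 + u1 * u1)%C.
Let V := (v2 + v1 * v1)%C.

Lemma v1_opp : v1 = (- u1)%C.
Proof.
  apply (Cmult_cancel_l b); [ apply RtoC_neq_0; lra | ].
  rewrite <- Ev1. transitivity (- (b * u1))%C; [ rewrite <- Eu1 | ]; ring.
Qed.

(** The two relations of second order determine [a3 - a2^2] by their difference
    and [a2^2] by their sum: as [v1 = - u1], the terms in [B2] cancel in the former and add
    up in the latter. *)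
Lemma coef_difference :
  ((4 + 12 * alpha) * a3 = (4 + 12 * alpha) * (a2 * a2) + b * (U - V))%C.
Proof.
  unfold U, V. rewrite v1_opp in *.
  replace (b * (u2 + u1 * u1 - (v2 + - u1 * - u1)))%C
    with ((b * u2 + B2 * (u1 * u1)) - (b * v2 + B2 * (- u1 * - u1)))%C by ring.
  rewrite <- Eu2, <- Ev2. ring.
Qed.

Lemma coef_sum :
  ((2 + 8 * alpha) * (a2 * a2) = b * (U + V) + 2 * (B2 - b) * (u1 * u1))%C.
Proof.
  unfold U, V. rewrite v1_opp in *.
  replace (b * (u2 + u1 * u1 + (v2 + - u1 * - u1)) + 2 * (B2 - b) * (u1 * u1))%C
    with ((b * u2 + B2 * (u1 * u1)) + (b * v2 + B2 * (- u1 * - u1)))%C by ring.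
  rewrite <- Eu2, <- Ev2. ring.
Qed.

(** The square of the first-order relation replaces [u1^2] by a multiple of
    [a2^2] in [coef_sum]. *)
Lemma a2_identity :
  (2 * (a2 * a2) * (b ^ 2 * (1 + 4 * alpha) + (b - B2) * (1 + 2 * alpha) ^ 2)
   = RtoC (b ^ 3) * (U + V))%C.
Proof.
  rewrite RtoC_pow.
  transitivity (b ^ 2 * ((2 + 8 * alpha) * (a2 * a2))
    + 2 * (b - B2) * (((1 + 2 * alpha) * a2) * ((1 + 2 * alpha) * a2)))%C; [ ring | ].
  rewrite coef_sum, Eu1. ring.
Qed.

Lemma a2_bound :
  (b ^ 2 * (1 + 4 * alpha) + (b - B2) * (1 + 2 * alpha) ^ 2)%C <> 0%C ->
  Cmod a2 <= b * sqrt b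
    / sqrt (Cmod (b ^ 2 * (1 + 4 * alpha) + (b - B2) * (1 + 2 * alpha) ^ 2)%C).
Proof.
  intros NE. assert (E := f_equal Cmod a2_identity).
  set (D := (b ^ 2 * (1 + 4 * alpha) + (b - B2) * (1 + 2 * alpha) ^ 2)%C) in *.
  assert (HD : 0 < Cmod D) by (apply Cmod_gt_0; exact NE).
  rewrite !Cmod_mult, !Cmod_R, !Rabs_pos_eq in E; [ | apply pow_le; lra | lra ].
  assert (T := Cmod_triangle U V). fold U in Bu2. fold V in Bv2.
  assert (Hb3 : 0 < b ^ 3) by (apply pow_lt; lra).
  assert (S : Cmod a2 * Cmod a2 * Cmod D <= b ^ 3) by nra.
  assert (Hs : 0 < sqrt (Cmod D)) by (apply sqrt_lt_R0; exact HD).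
  apply Rle_div_r; [ exact Hs | ].
  replace (b * sqrt b) with (sqrt (b ^ 3)).
  - rewrite <- (sqrt_square (Cmod a2)) by apply Cmod_ge_0.
    rewrite <- sqrt_mult_alt by (apply Rmult_le_pos; apply Cmod_ge_0).
    apply sqrt_le_1_alt, S.
  - replace (b ^ 3) with (b * b * b) by ring.
    rewrite sqrt_mult_alt by nra. rewrite sqrt_square by lra. reflexivity.
Qed.

(** Eliminating [a2^2] gives [(1 + 4 alpha) a3] as [b] times a combination of [U]
    and [V] plus [(B2 - b) u1^2]. The weights are [1/2 + s] and [1/2 - s] with
    [s = (1 + 4 alpha) / (4 (1 + 3 alpha)) <= 1/2], so both are nonnegative and
    the combination has modulus at most 1. *)
Lemma a3_bound : Cmod a3 <= (b + Cmod (B2 - b)%C) / (1 + 4 * alpha).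
Proof.
  assert (P1 : 0 < 1 + 4 * alpha) by lra. assert (P2 : 0 < 1 + 3 * alpha) by lra.
  apply Rle_div_r; [ exact P1 | ].
  set (s := (1 + 4 * alpha) / (4 * (1 + 3 * alpha))).
  assert (Hs : 0 < s <= / 2).
  { split; [ apply Rdiv_lt_0_compat; lra | ].
    unfold s. apply Rle_div_l; [ lra | ]. lra. }
  assert (E : (RtoC (1 + 4 * alpha) * a3
    = RtoC (b * (/ 2 + s)) * U + RtoC (b * (/ 2 - s)) * V + (B2 - b) * (u1 * u1))%C).
  { assert (N4 : RtoC (4 * (1 + 3 * alpha)) <> 0%C) by (apply RtoC_neq_0; lra).
    assert (Hss : (4 * (1 + 3 * alpha)) * s = 1 + 4 * alpha) by (unfold s; field; lra).
    assert (Hsc := f_equal RtoC Hss).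
    apply (Cmult_cancel_l _ _ _ N4).
    rewrite !RtoC_mult, ?RtoC_minus, !RtoC_plus, ?RtoC_inv, ?RtoC_mult in * by lra.
    transitivity ((1 + 4 * alpha) * ((4 + 12 * alpha) * a3))%C; [ ring | ].
    rewrite coef_difference.
    transitivity ((2 + 6 * alpha) * ((2 + 8 * alpha) * (a2 * a2))
                  + (1 + 4 * alpha) * (b * (U - V)))%C; [ ring | ].
    rewrite coef_sum, <- Hsc. field. }
  rewrite <- (Rabs_pos_eq (1 + 4 * alpha)), <- Cmod_R, Rmult_comm, <- Cmod_mult, E by lra.
  fold U in Bu2. fold V in Bv2.
  apply Rle_trans with (1 := Cmod_triangle _ _).
  apply Rplus_le_compat.
  - apply Rle_trans with (1 := Cmod_triangle _ _).
    rewrite !Cmod_mult, !Cmod_R, !Rabs_pos_eq by (apply Rmult_le_pos; lra).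
    assert (0 <= b * (/ 2 + s)) by (apply Rmult_le_pos; lra).
    assert (0 <= b * (/ 2 - s)) by (apply Rmult_le_pos; lra).
    nra.
  - rewrite !Cmod_mult.
    assert (X := Cmod_ge_0 (B2 - b)%C). assert (Y := Cmod_ge_0 u1).
    rewrite <- (Rmult_1_r (Cmod (B2 - b)%C)) at 2.
    apply Rmult_le_compat_l; nra.
Qed.
End Algebra.

Theorem theorem2p2 (alpha : R) (phi f : C -> C) (B a : nat -> C)
    (halpha : 0 <= alpha)
    (hphi : admissible_phi phi)
    (hB0 : B 0%nat = 1%C) (hB : taylor_expansion phi B)
    (ha0 : a 0%nat = 0%C) (ha1 : a 1%nat = 1%C) (ha : taylor_expansion f a)
    (hf : class_ST alpha phi f) :
  (((B 1%nat) ^ 2 * (1 + 4 * alpha)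
      + (B 1%nat - B 2%nat) * (1 + 2 * alpha) ^ 2)%C <> 0%C ->
   Cmod (a 2%nat) <=
     Re (B 1%nat) * sqrt (Re (B 1%nat))
     / sqrt (Cmod ((B 1%nat) ^ 2 * (1 + 4 * alpha)
                   + (B 1%nat - B 2%nat) * (1 + 2 * alpha) ^ 2)%C))
  /\  Cmod (a 3%nat) <=
    (Re (B 1%nat) + Cmod (B 2%nat - B 1%nat)%C) / (1 + 4 * alpha).
Proof.
  destruct hphi as (_ & _ & phi0 & Hpos & _).
  destruct hf as [_ (g & Hg & (F & HF & SF) & (G & HG & SG))].
  rewrite (taylor_at_0 _ _ (taylor_C_derive phi B hB)) in Hpos.
  replace (Cderive_coef B 0) with (B 1%nat) in Hpos
    by (unfold Cderive_coef; simpl INR; ring).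
  destruct Hpos as [Hb1 Hb2].
  set (b := Re (B 1%nat)) in *.
  assert (Eb : B 1%nat = RtoC b) by (apply injective_projections; [ reflexivity | exact Hb2 ]).
  assert (Nb : B 1%nat <> 0%C) by (rewrite Eb; apply RtoC_neq_0; lra).
  assert (F0 : F 0%C = 1%C) by (rewrite (subordinate_0 F phi SF); exact phi0).
  assert (G0 : G 0%C = 1%C) by (rewrite (subordinate_0 G phi SG); exact phi0).
  assert (JF := st_expr_jet2 f a ha ha0 ha1 alpha F F0 HF).
  assert (JG := st_expr_inverse_jet2 f a ha ha0 ha1 g Hg alpha G G0 HG).
  rewrite <- hB0 in JF at 1. rewrite <- hB0 in JG at 1.
  destruct (subordinate_jet2 phi F B _ _ hB Nb SF JF) as (u1 & u2 & Eu1 & Eu2 & Bu1 & Bu2).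
  destruct (subordinate_jet2 phi G B _ _ hB Nb SG JG) as (v1 & v2 & Ev1 & Ev2 & _ & Bv2).
  rewrite Eb in *. split.
  - apply (a2_bound alpha b (a 2%nat) (a 3%nat) (B 2%nat) u1 u2 v1 v2); assumption.
  - apply (a3_bound alpha b (a 2%nat) (a 3%nat) (B 2%nat) u1 u2 v1 v2); assumption.
Qed.
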